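(* Let $\Bbbk$ be an algebraically closed field of characteristic zero, let $H$ be a semisimple Hopf algebra over $\Bbbk$ (hence finite-dimensional), and let $\tau$ be a Hopf algebra automorphism of $H$ of finite order $r$. Let $V$ be a finite-dimensional left $H$-module with character $\chi$. If $m=kr$ with $k$ a positive integer, then the $m$-th twisted Frobenius--Schur indicator $\nu_m(\chi,\tau)$ is given by $$\nu_m(\chi,\tau)=\frac{1}{\dim H}\operatorname{tr}\left(q_\tau^k|_{V\otimes H^*}\right).$$
   Context: Twisted Sweedler power: for $h\in H$ and a positive integer $j$, $\tilde h^{[j]}=\sum_{(h)}h_1\tau(h_2)\cdots\tau^{j-1}(h_j)$, where $\Delta^{j-1}(h)=\sum_{(h)}h_1\otimes\cdots\otimes h_j$ is the iterated comultiplication in Sweedler notation. $\Lambda\in H$ is the unique two-sided integral with $\varepsilon(\Lambda)=1$, where $\varepsilon$ is the counit. Twisted Frobenius--Schur indicator: for $m$ a positive multiple of $r$, $\nu_m(\chi,\tau)=\chi(\tilde\Lambda^{[m]})$. The element $q_\tau$: let $b_1,\dots,b_n$ be a basis of $H$ with dual basis $b_1^*,\dots,b_n^*$ of $H^*$, and let $\tau^*:H^*\to H^*$ be the transpose of $\tau$, $\tau^*(\alpha)=\alpha\circ\tau$. In the tensor product algebra $H\otimes H^*$ (where $H^*$ has the convolution product $(\alpha\beta)(h)=\sum\alpha(h_1)\beta(h_2)$, with unit $\varepsilon$) put $$q_\tau=\prod_{i=0}^{r-1}\Big(\sum_{j} b_j\otimes(\tau^* )^i(b_j^* )\Big)=\sum_{i_1,\dots,i_r}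 b_{i_1}\cdots b_{i_r}\otimes b_{i_1}^*\,\tau^*(b_{i_2}^* )\cdots(\tau^* )^{r-1}(b_{i_r}^* ),$$ the factors being taken in the order $i=0,1,\dots,r-1$ from left to right. It is independent of the chosen basis. The algebra $H\otimes H^*$ acts on $V\otimes H^*$ via the module action of $H$ on $V$ and left multiplication of $H^*$ on $H^*$; for $x\in H\otimes H^*$, $x|_{V\otimes H^*}$ denotes the resulting linear operator. *)

(* Defs.v *)
From HB Require Import structures.
From mathcomp Require Import all_boot all_order all_algebra all_field.

Set Implicit Arguments.
Unset Strict Implicit.
Unset Printing Implicit Defensive.

Import GRing.Theory.

Local Open Scope ring_scope.

Definition lftrace (K : fieldType) (V : vectType K) (f : 'End(V)) : K :=
  let e := vbasis {:V} in \tr (passmx.mxof e e f).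

(* For finite-dimensional U, the tensor product of U and V is modelled by the
   space Hom(U^*, V): the pure tensor u ⊗ v is alpha |-> alpha(u) v. The lemmas
   tens_ind and tlift_tens below give the universal property. *)
Definition tensor (K : fieldType) (U V : vectType K) : Type :=
  'Hom('Hom(U, K^o), V).

HB.instance Definition _ (K : fieldType) (U V : vectType K) :=
  Vector.copy (tensor U V) 'Hom('Hom(U, K^o), V).

Section Tensor.

Variable K : fieldType.
Implicit Types U V W : vectType K.

Definition tens U V (u : U) (v : V) : tensor U V :=
  linfun (fun alpha : 'Hom(U, K^o) => (alpha u : K) *: v).

(* The linear map on U ⊗ V induced by a bilinear map b. *)
Definition tlift U V (W : lmodType K) (b : U -> V -> W) (t : tensor U V) : W :=
  let e := vbasis {:U} in
  \sum_(i < \dim {:U}) b e`_i (fun_of_lfun t (linfun (coord e i : U -> K^o))).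

Definition tmap U V U' V' (f : U -> U') (g : V -> V') :
    tensor U V -> tensor U' V' :=
  tlift (fun u v => tens (f u) (g v)).

Definition tassoc U V W : tensor (tensor U V) W -> tensor U (tensor V W) :=
  tlift (fun t w => tlift (fun u v => tens u (tens v w)) t).

Lemma tensE U V (u : U) (v : V) alpha :
  fun_of_lfun (tens u v) alpha = (alpha u : K) *: v.
Proof.
pose f (alpha : 'Hom(U, K^o)) := (alpha u : K) *: v.
have lf : linear f.
  by move=> a x y; rewrite /f !lfunE /= lfunE /= scalerDl scalerA.
pose fL : {linear _ -> _} := HB.pack f (GRing.isLinear.Build _ _ _ _ f lf).
exact: (lfunE fL).
Qed.

Lemma tens_linearl U V (v : V) : linear (fun u : U => tens u v).
Proof.
move=> a x y; apply/lfunP => alpha.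
by rewrite add_lfunE scale_lfunE !tensE linearP scalerDl scalerA.
Qed.

Lemma tens_linearr U V (u : U) : linear (fun v : V => tens u v).
Proof.
move=> a x y; apply/lfunP => alpha.
by rewrite add_lfunE scale_lfunE !tensE scalerDr !scalerA mulrC.
Qed.

Lemma tens_sumE U V n (F : 'I_n -> tensor U V) alpha :
  fun_of_lfun (\sum_(i < n) F i) alpha = \sum_(i < n) fun_of_lfun (F i) alpha.
Proof. exact: (@sum_lfunE _ _ _ 'I_n _ _ F). Qed.

Lemma tens_decomp U V (t : tensor U V) : t = tlift (@tens U V) t.
Proof.
apply/lfunP => alpha; rewrite /tlift tens_sumE.
under eq_bigr => i _ do rewrite tensE -linearZ.
rewrite -linear_sum; congr (fun_of_lfun t _); apply/lfunP => u.
rewrite sum_lfunE [in LHS](coord_vbasis (memvf u)) linear_sum.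
by apply: eq_bigr => i _; rewrite scale_lfunE linearZ lfunE; apply: mulrC.
Qed.

Lemma tens_ind U V (P : tensor U V -> Prop) :
    (forall u v, P (tens u v)) -> P 0 ->
    (forall s t, P s -> P t -> P (s + t)) ->
  forall t, P t.
Proof.
move=> Pt P0 PD t; rewrite (tens_decomp t) /tlift.
by elim/big_ind: _.
Qed.

Lemma tlift_tens U V (W : lmodType K) (b : U -> V -> W) :
    (forall v, linear (fun u => b u v)) -> (forall u, linear (b u)) ->
  forall u v, tlift b (tens u v) = b u v.
Proof.
move=> bl br u v; pose e := vbasis {:U}.
pose bL v : {linear _ -> _} :=
  HB.pack (fun u => b u v) (GRing.isLinear.Build _ _ _ _ (fun u => b u v) (bl v)).
pose bR u : {linear _ -> _} :=
  HB.pack (b u) (GRing.isLinear.Build _ _ _ _ (b u) (br u)).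
have {2}-> : u = \sum_i coord e i u *: e`_i.
  by apply: coord_vbasis; rewrite memvf.
rewrite -[RHS]/(bL v _) linear_sum; apply: eq_bigr => i _.
rewrite tensE lfunE.
by rewrite -[LHS]/(bR e`_i (coord e i u *: v)) -[RHS]/(bL v _) !linearZ.
Qed.

Lemma tlift_linear U V (W : lmodType K) (b : U -> V -> W) :
  (forall u, linear (b u)) -> linear (tlift b).
Proof.
move=> br a s t; rewrite /tlift scaler_sumr -big_split /=.
by apply: eq_bigr => i _; rewrite add_lfunE scale_lfunE br.
Qed.

Lemma eq_tlift U V (W : lmodType K) (b b' : U -> V -> W) :
  (forall u v, b u v = b' u v) -> tlift b =1 tlift b'.
Proof. by move=> bb' t; apply: eq_bigr => i _. Qed.

Lemma linear_tlift U V (W W' : lmodType K) (b : U -> V -> W) (f : W -> W') t :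
  linear f -> f (tlift b t) = tlift (fun u v => f (b u v)) t.
Proof.
move=> lf; pose fL : {linear _ -> _} :=
  HB.pack f (GRing.isLinear.Build _ _ _ _ f lf).
by rewrite -[LHS]/(fL _) linear_sum.
Qed.

Lemma tlift_tmap U V U' V' (W : lmodType K) (b : U' -> V' -> W)
    (f : U -> U') (g : V -> V') t :
    (forall v, linear (fun u => b u v)) -> (forall u, linear (b u)) ->
  tlift b (tmap f g t) = tlift (fun u v => b (f u) (g v)) t.
Proof.
move=> bl br; rewrite /tmap linear_tlift; last exact: tlift_linear.
by apply: eq_tlift => u v; rewrite tlift_tens.
Qed.

End Tensor.

Section TensorAlgebra.

Variables (K : fieldType) (A B : falgType K).

Definition tens_one : tensor A B := tens 1 1.

Definition tens_mul (s t : tensor A B) : tensor A B :=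
  tlift (fun a b => tlift (fun a' b' => tens (a * a') (b * b')) t) s.

Let linl (a : A) (b b' : B) : linear (fun a' : A => tens (a * a') (b * b')).
Proof. by move=> c x y; rewrite mulrDr -scalerAr tens_linearl. Qed.

Let linr (a a' : A) (b : B) : linear (fun b' : B => tens (a * a') (b * b')).
Proof. by move=> c x y; rewrite mulrDr -scalerAr tens_linearr. Qed.

Let linl2 (b : B) (t : tensor A B) :
  linear (fun a : A => tlift (fun a' b' => tens (a * a') (b * b')) t).
Proof.
move=> c x y; rewrite /tlift scaler_sumr -big_split; apply: eq_bigr => i _ /=.
by rewrite mulrDl -scalerAl tens_linearl.
Qed.

Let linr2 (a : A) (t : tensor A B) :
  linear (fun b : B => tlift (fun a' b' => tens (a * a') (b * b')) t).
Proof.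
move=> c x y; rewrite /tlift scaler_sumr -big_split; apply: eq_bigr => i _ /=.
by rewrite mulrDl -scalerAl tens_linearr.
Qed.

Lemma tens_mulE (a a' : A) (b b' : B) :
  tens_mul (tens a b) (tens a' b') = tens (a * a') (b * b').
Proof. by rewrite /tens_mul tlift_tens // tlift_tens. Qed.

Fact tens_mul_linearl t : linear (tens_mul^~ t).
Proof. exact: (tlift_linear (fun a => linr2 a t)). Qed.

Fact tens_mul_linearr s : linear (tens_mul s).
Proof.
move=> c x y; rewrite /tens_mul /tlift scaler_sumr -big_split.
apply: eq_bigr => i _; exact: (tlift_linear (fun a => @linr _ a _)).
Qed.

Fact tens_mulDl : left_distributive tens_mul +%R.
Proof. by move=> x y z; have := tens_mul_linearl z 1 x y; rewrite !scale1r. Qed.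

Fact tens_mulDr : right_distributive tens_mul +%R.
Proof. by move=> z x y; have := tens_mul_linearr z 1 x y; rewrite !scale1r. Qed.

Fact tens_mul0l t : tens_mul 0 t = 0.
Proof. by apply: (addrI (tens_mul 0 t)); rewrite -tens_mulDl !addr0. Qed.

Fact tens_mul0r t : tens_mul t 0 = 0.
Proof. by apply: (addrI (tens_mul t 0)); rewrite -tens_mulDr !addr0. Qed.

Fact tens_mulA : associative tens_mul.
Proof.
move=> x y z.
elim/tens_ind: x => [a1 b1||x x' IH IH']; last 2 first.
- by rewrite !tens_mul0l.
- by rewrite !tens_mulDl IH IH'.
elim/tens_ind: y => [a2 b2||x x' IH IH']; last 2 first.
- by rewrite !(tens_mul0l, tens_mul0r).
- by rewrite !(tens_mulDl, tens_mulDr) IH IH'.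
elim/tens_ind: z => [a3 b3||x x' IH IH']; last 2 first.
- by rewrite !tens_mul0r.
- by rewrite !tens_mulDr IH IH'.
by rewrite !tens_mulE !mulrA.
Qed.

Fact tens_mul1l : left_id tens_one tens_mul.
Proof.
elim/tens_ind => [a b||x x' IH IH']; last 2 first.
- by rewrite tens_mul0r.
- by rewrite tens_mulDr IH IH'.
by rewrite tens_mulE !mul1r.
Qed.

Fact tens_mul1r : right_id tens_one tens_mul.
Proof.
elim/tens_ind => [a b||x x' IH IH']; last 2 first.
- by rewrite tens_mul0l.
- by rewrite tens_mulDl IH IH'.
by rewrite tens_mulE !mulr1.
Qed.

Fact tens_one_neq0 : tens_one != 0.
Proof.
apply/eqP => t0.
pose e := vbasis {:A}.
have [i ni0] : exists i, coord e i 1 != 0.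
  apply/existsP; apply: contraT; rewrite negb_exists => /forallP c0.
  have := oner_neq0 A; rewrite [1](coord_vbasis (memvf _)) big1 ?eqxx // => i _.
  by move/negPn/eqP: (c0 i); rewrite -/e => ->; rewrite scale0r.
have := congr1 (fun t : tensor A B =>
  fun_of_lfun t (linfun (coord e i : A -> K^o))) t0.
rewrite zero_lfunE tensE lfunE => /eqP.
by rewrite scaler_eq0 (negPf ni0) oner_eq0.
Qed.

HB.instance Definition _ := GRing.Zmodule_isNzRing.Build (tensor A B)
  tens_mulA tens_mul1l tens_mul1r tens_mulDl tens_mulDr tens_one_neq0.

Fact tens_scaleAl (c : K) (s t : tensor A B) : c *: (s * t) = (c *: s) * t.
Proof.
have := tens_mul_linearl t c s 0.
by rewrite addr0 tens_mul0l addr0.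
Qed.

HB.instance Definition _ :=
  GRing.Lmodule_isLalgebra.Build K (tensor A B) tens_scaleAl.

Fact tens_scaleAr (c : K) (s t : tensor A B) : c *: (s * t) = s * (c *: t).
Proof.
have := tens_mul_linearr s c t 0.
by rewrite addr0 tens_mul0r addr0.
Qed.

HB.instance Definition _ :=
  GRing.Lalgebra_isAlgebra.Build K (tensor A B) tens_scaleAr.

HB.instance Definition _ := Algebra_isFalgebra.Build K (tensor A B).

End TensorAlgebra.

HB.mixin Record Falgebra_isHopf (K : fieldType) H of Falgebra K H := {
  comul_subdef : {lrmorphism H -> tensor H H};
  counit_subdef : {lrmorphism H -> K | *%R};
  antipode_subdef : {linear H -> H};
  comulA_subproof : forall h : H,
    tassoc (tmap comul_subdef id (comul_subdef h)) =
    tmap id comul_subdef (comul_subdef h);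
  counitl_subproof : forall h : H,
    tlift (fun a b : H => counit_subdef a *: b) (comul_subdef h) = h;
  counitr_subproof : forall h : H,
    tlift (fun a b : H => counit_subdef b *: a) (comul_subdef h) = h;
  antipodel_subproof : forall h : H,
    tlift (fun a b : H => antipode_subdef a * b) (comul_subdef h) =
    (counit_subdef h)%:A;
  antipoder_subproof : forall h : H,
    tlift (fun a b : H => a * antipode_subdef b) (comul_subdef h) =
    (counit_subdef h)%:A
}.

#[short(type="hopfAlgType")]
HB.structure Definition HopfAlgebra (K : fieldType) :=
  { H of Falgebra K H & Falgebra_isHopf K H }.

Section HopfAlgebraTheory.

Variables (K : fieldType) (H : hopfAlgType K).

Definition comul : {lrmorphism H -> tensor H H} := @comul_subdef K H.

Definition counit : {lrmorphism H -> K | *%R} := @counit_subdef K H.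

Definition antipode : {linear H -> H} := @antipode_subdef K H.

Lemma comulA (h : H) :
  tassoc (tmap comul id (comul h)) = tmap id comul (comul h).
Proof. exact: comulA_subproof. Qed.

Lemma counitl (h : H) : tlift (fun a b : H => counit a *: b) (comul h) = h.
Proof. exact: counitl_subproof. Qed.

Lemma counitr (h : H) : tlift (fun a b : H => counit b *: a) (comul h) = h.
Proof. exact: counitr_subproof. Qed.

Lemma antipodel (h : H) :
  tlift (fun a b : H => antipode a * b) (comul h) = (counit h)%:A.
Proof. exact: antipodel_subproof. Qed.

Lemma antipoder (h : H) :
  tlift (fun a b : H => a * antipode b) (comul h) = (counit h)%:A.
Proof. exact: antipoder_subproof. Qed.

End HopfAlgebraTheory.

Arguments comul {K H}.
Arguments counit {K H}.
Arguments antipode {K H}.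

(* H^* with the convolution product. *)
Definition dual (K : fieldType) (H : hopfAlgType K) : Type := 'Hom(H, K^o).

Section DualAlgebra.

Variables (K : fieldType) (H : hopfAlgType K).

HB.instance Definition _ := Vector.copy (dual H) 'Hom(H, K^o).

Definition deval (alpha : dual H) (h : H) : K := fun_of_lfun alpha h.

Definition dual_one : dual H := linfun (counit : H -> K^o).

Definition dual_mul (alpha beta : dual H) : dual H :=
  linfun (fun h : H =>
    tlift (fun a b : H => deval alpha a * deval beta b : K^o) (comul h)).

Fact deval_linear alpha : linear (deval alpha : H -> K^o).
Proof. by move=> c x y; rewrite /deval linearP. Qed.

Fact devalD alpha beta h : deval (alpha + beta) h = deval alpha h + deval beta h.
Proof. by rewrite /deval add_lfunE. Qed.

Fact devalZ c alpha h : deval (c *: alpha) h = c * deval alpha h.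
Proof. by rewrite /deval scale_lfunE. Qed.

Lemma dualP (alpha beta : dual H) :
  (forall h, deval alpha h = deval beta h) -> alpha = beta.
Proof. by move=> ab; apply/lfunP. Qed.

Lemma dual_oneE h : deval dual_one h = counit h.
Proof.
have lc : linear (counit : H -> K^o) by move=> c x y; rewrite linearP.
pose cL : {linear H -> K^o} :=
  HB.pack (counit : H -> K^o) (GRing.isLinear.Build _ _ _ _ _ lc).
exact: (lfunE cL).
Qed.

Let linl (f : H -> K^o) (g : K) :
  linear f -> linear (fun a : H => (f a : K) * g : K^o).
Proof. by move=> lf c x y; rewrite lf mulrDl; congr (_ + _); rewrite [RHS]mulrA. Qed.

Let linr (f : H -> K^o) (g : K) :
  linear f -> linear (fun a : H => g * (f a : K) : K^o).
Proof. by move=> lf c x y; rewrite lf mulrDr; congr (_ + _); rewrite [RHS]mulrCA. Qed.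

Lemma dual_mulE alpha beta h :
  deval (dual_mul alpha beta) h =
  tlift (fun a b : H => deval alpha a * deval beta b : K^o) (comul h).
Proof.
pose f (h : H) : K^o :=
  tlift (fun a b : H => deval alpha a * deval beta b : K^o) (comul h).
have lf : linear f.
  move=> c x y; rewrite /f linearP tlift_linear // => u.
  exact/linr/deval_linear.
pose fL : {linear _ -> _} := HB.pack f (GRing.isLinear.Build _ _ _ _ f lf).
exact: (lfunE fL).
Qed.

Fact dual_mulA : associative dual_mul.
Proof.
move=> x y z; apply: dualP => h; rewrite !dual_mulE.
pose g3 (u : H) (t : tensor H H) : K^o :=
  deval x u * tlift (fun a b : H => deval y a * deval z b : K^o) t.
have g3l t : linear (g3^~ t) by apply/linl/deval_linear.
have yzl : linear (tlift (fun a b : H => deval y a * deval z b : K^o)).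
  by apply: tlift_linear => a; apply/linr/deval_linear.
have g3r u : linear (g3 u).
  by move=> c s t; rewrite /g3 yzl mulrDr; congr (_ + _); rewrite [RHS]mulrCA.
have xyl : linear (tlift (fun a b : H => deval x a * deval y b : K^o)).
  by apply: tlift_linear => a; apply/linr/deval_linear.
pose g3' (t : tensor H H) (w : H) : K^o :=
  (tlift (fun a b : H => deval x a * deval y b : K^o) t : K) * deval z w.
have g3'l w : linear (g3'^~ w).
  by move=> c s t; rewrite /g3' xyl mulrDl; congr (_ + _); rewrite [RHS]mulrA.
have g3'r t : linear (g3' t) by apply/linr/deval_linear.
have g3E t : tlift g3 (tassoc t) = tlift g3' t.
  rewrite /tassoc (linear_tlift _ _ (tlift_linear g3r)).
  apply: (@eq_tlift _ _ _ K^o) => s w.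
  rewrite (linear_tlift _ _ (tlift_linear g3r)).
  have lw : linear (fun v : K^o => (v : K) * deval z w : K^o).
    by move=> c p q; rewrite mulrDl; congr (_ + _); rewrite [RHS]mulrA.
  rewrite /g3' (linear_tlift _ s lw).
  apply: (@eq_tlift _ _ _ K^o) => u v.
  rewrite (tlift_tens g3l g3r) /g3 tlift_tens.
  - exact: mulrA.
  - by move=> p; apply/linl/deval_linear.
  - by move=> p; apply/linr/deval_linear.
transitivity (tlift g3 (tmap id comul (comul h))).
  rewrite (tlift_tmap _ _ _ g3l g3r).
  by apply: (@eq_tlift _ _ _ K^o) => a b; rewrite /g3 dual_mulE.
rewrite -comulA g3E (tlift_tmap _ _ _ g3'l g3'r).
by apply: (@eq_tlift _ _ _ K^o) => a b; rewrite /g3' dual_mulE.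
Qed.

Fact dual_mul1l : left_id dual_one dual_mul.
Proof.
move=> x; apply: dualP => h; rewrite dual_mulE -[in RHS](counitl h).
rewrite (linear_tlift _ _ (deval_linear x)).
apply: (@eq_tlift _ _ _ K^o) => a b; rewrite dual_oneE.
by have := deval_linear x (counit a) b 0; rewrite !addr0 /deval linear0 addr0.
Qed.

Fact dual_mul1r : right_id dual_one dual_mul.
Proof.
move=> x; apply: dualP => h; rewrite dual_mulE -[in RHS](counitr h).
rewrite (linear_tlift _ _ (deval_linear x)).
apply: (@eq_tlift _ _ _ K^o) => a b; rewrite dual_oneE mulrC.
by have := deval_linear x (counit b) a 0; rewrite !addr0 /deval linear0 addr0.
Qed.

Fact dual_mulDl : left_distributive dual_mul +%R.
Proof.
move=> x y z; apply: dualP => h; rewrite devalD !dual_mulE -big_split.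
by apply: eq_bigr => i _; rewrite devalD mulrDl.
Qed.

Fact dual_mulDr : right_distributive dual_mul +%R.
Proof.
move=> z x y; apply: dualP => h; rewrite devalD !dual_mulE -big_split.
by apply: eq_bigr => i _; rewrite devalD mulrDr.
Qed.

Fact dual_one_neq0 : dual_one != 0.
Proof.
apply/eqP => e0; have := dual_oneE 1.
by rewrite e0 /deval zero_lfunE rmorph1 => /esym/eqP; rewrite oner_eq0.
Qed.

HB.instance Definition _ := GRing.Zmodule_isNzRing.Build (dual H)
  dual_mulA dual_mul1l dual_mul1r dual_mulDl dual_mulDr dual_one_neq0.

Fact dual_scaleAl (c : K) (x y : dual H) : c *: (x * y) = (c *: x) * y.
Proof.
apply: dualP => h; rewrite devalZ !dual_mulE [LHS]scaler_sumr.
by apply: eq_bigr => i _; rewrite devalZ -mulrA.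
Qed.

HB.instance Definition _ :=
  GRing.Lmodule_isLalgebra.Build K (dual H) dual_scaleAl.

Fact dual_scaleAr (c : K) (x y : dual H) : c *: (x * y) = x * (c *: y).
Proof.
apply: dualP => h; rewrite devalZ !dual_mulE [LHS]scaler_sumr.
by apply: eq_bigr => i _; rewrite devalZ mulrCA.
Qed.

HB.instance Definition _ :=
  GRing.Lalgebra_isAlgebra.Build K (dual H) dual_scaleAr.

HB.instance Definition _ := Algebra_isFalgebra.Build K (dual H).

End DualAlgebra.

Section TwistedIndicators.

Variables (K : fieldType) (H : hopfAlgType K).

Definition left_ideal (I : {vspace H}) : Prop :=
  forall a x : H, x \in I -> a * x \in I.

(* The left regular module is semisimple. *)
Definition semisimple : Prop :=
  forall I : {vspace H}, left_ideal I ->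
  exists J : {vspace H},
    [/\ left_ideal J, (I + J)%VS = fullv & (I :&: J)%VS = 0%VS].

Definition integral (x : H) : Prop :=
  forall h : H, h * x = counit h *: x /\ x * h = counit h *: x.

Lemma integral_uniq (x y : H) :
  integral x -> integral y -> counit x = 1 -> counit y = 1 -> x = y.
Proof.
move=> ix iy x1 y1; have [_] := ix y; have [] := iy x.
by rewrite x1 y1 !scale1r => -> _ ->.
Qed.

(* Compatibility with the antipode is automatic. *)
Definition hopf_automorphism (tau : {lrmorphism H -> H}) : Prop :=
  [/\ bijective tau,
      forall h, comul (tau h) = tmap tau tau (comul h) &
      forall h, counit (tau h) = counit h].

Definition has_order (tau : H -> H) (r : nat) : Prop :=
  [/\ (0 < r)%N, iter r tau =1 id &
      forall s, (0 < s < r)%N -> ~ iter s tau =1 id].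

(* The (n+1)-fold tensor power H ⊗ (H ⊗ ... ⊗ H). *)
Fixpoint tens_pow (n : nat) : vectType K :=
  if n is n'.+1 then tensor H (tens_pow n') else H.

Fixpoint comul_iter (n : nat) : H -> tens_pow n :=
  match n with
  | 0 => id
  | n'.+1 => fun h => tmap id (@comul_iter n') (comul h)
  end.

(* h_0 ⊗ ... ⊗ h_n |-> tau^i(h_0) tau^(i+1)(h_1) ... tau^(i+n)(h_n) *)
Fixpoint twisted_mul (tau : H -> H) (i n : nat) : tens_pow n -> H :=
  match n with
  | 0 => iter i tau
  | n'.+1 => tlift (fun (a : H) (t : tens_pow n') =>
                      iter i tau a * @twisted_mul tau i.+1 n' t)
  end.

(* Only meaningful for 0 < j. *)
Definition twisted_sweedler_power (tau : H -> H) (j : nat) (h : H) : H :=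
  @twisted_mul tau 0 j.-1 (@comul_iter j.-1 h).

Record hmodule (V : vectType K) := HModule {
  hact :> {linear H -> 'End(V)};
  hact1 : hact 1 = \1%VF;
  hactM : forall a b : H, hact (a * b) = (hact a \o hact b)%VF
}.

Definition hchar (V : vectType K) (rho : hmodule V) (h : H) : K :=
  lftrace (rho h).

Definition twisted_indicator (Lambda : H) (tau : H -> H) (V : vectType K)
    (rho : hmodule V) (m : nat) : K :=
  hchar rho (twisted_sweedler_power tau m Lambda).

Definition dual_basis n (b : n.-tuple H) (j : 'I_n) : dual H :=
  linfun (coord b j : H -> K^o).

Definition transpose (tau : H -> H) (alpha : dual H) : dual H :=
  linfun (fun h : H => deval alpha (tau h) : K^o).

(* The product is taken in increasing order of i, from left to right. *)
Definition q_tau n (b : n.-tuple H) (tau : H -> H) (r : nat) :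
    tensor H (dual H) :=
  \prod_(i < r) \sum_(j < n)
    tens b`_j (iter i (transpose tau) (dual_basis b j)).

Definition tens_act (V : vectType K) (rho : hmodule V)
    (x : tensor H (dual H)) : 'End(tensor V (dual H)) :=
  tlift (fun (a : H) (alpha : dual H) =>
           linfun (tmap (rho a) (fun beta : dual H => alpha * beta))) x.

Lemma tens_actE (V : vectType K) (rho : hmodule V) a alpha v beta :
  tens_act rho (tens a alpha) (tens v beta) = tens (rho a v) (alpha * beta).
Proof.
have bl c gamma (w : dual H) : linear (fun v : V => tens (rho c v) (gamma * w)).
  by move=> d x y; rewrite linearP tens_linearl.
have br c gamma w : linear (fun beta : dual H => tens (rho c w) (gamma * beta)).
  by move=> d x y; rewrite mulrDr -scalerAr tens_linearr.
have lE c gamma t : linfun (tmap (rho c) (fun beta : dual H => gamma * beta)) t =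
    tmap (rho c) (fun beta : dual H => gamma * beta) t.
  have lt := tlift_linear (br c gamma).
  pose tL : {linear _ -> _} := HB.pack
    (tmap (rho c) (fun beta : dual H => gamma * beta))
    (GRing.isLinear.Build _ _ _ _ _ lt).
  exact: (lfunE tL).
rewrite /tens_act tlift_tens => [|gamma d x y|c d x y].
- by rewrite lE /tmap (tlift_tens (bl a alpha) (br a alpha)).
- apply/lfunP => t; rewrite add_lfunE scale_lfunE !lE /tmap /tlift scaler_sumr.
  rewrite -big_split; apply: eq_bigr => i _ /=.
  by rewrite linearP add_lfunE scale_lfunE tens_linearl.
- apply/lfunP => t; rewrite add_lfunE scale_lfunE !lE /tmap /tlift scaler_sumr.
  rewrite -big_split; apply: eq_bigr => i _ /=.
  by rewrite mulrDl -scalerAl tens_linearr.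
Qed.

End TwistedIndicators.

Arguments semisimple {K} H.

(* Main.v *)
(* A trace computation reduces the statement to tr(L_phi | H^* ) = dim(H) phi(Lambda)
   for all phi in H^*: under H (x) H^* = Hom(H, H) the product is convolution and
   q_tau^k corresponds to id * tau * ... * tau^(kr-1), so that pairing it with
   Lambda gives the twisted Sweedler power of Lambda.  The trace formula follows
   from S^2 = id, that is from the Larson-Radford theorem for semisimple Hopf
   algebras in characteristic 0, proved here in two steps.

   Let lam(h) = tr(x |-> S^2(x) h), a right integral in H^* with lam(Lambda) = 1,
   and w = S(Lambda_2) Lambda_1, so that w h = S^2(h) w and tr(L_h) = lam(h w).
   Nondegeneracy of the regular trace makes w invertible.  By Radford's formula
   S^4 is conjugation by a grouplike element, so S^2 has finite order, and on each
   block eH the element w is a multiple of an element of finite order; as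
   tr(w e) = tr(e), the trace of w^-1 e is |sum of roots of unity|^2 / dim(eH),
   hence tr(S^2) = lam(1) = tr(w^-1) is a sum of positive numbers and is nonzero.

   Then lam is a two-sided integral and S^4 = id.  The character h |-> tr(R_h) /
   dim(H) is an idempotent of H^*; it yields an idempotent P on H commuting with
   S^2 such that tr(S^2) = dim(H) tr(S^2 P).  As tr(S^2 P) is a nonzero integer
   and S^2 is an involution, all eigenvalues of S^2 agree. *)

Require Import Defs.
From HB Require Import structures.
From mathcomp Require Import all_boot all_order all_algebra all_field.
From mathcomp Require Import cyclic zify.
From Stdlib Require Import Classical_Prop.

Set Implicit Arguments.
Unset Strict Implicit.
Unset Printing Implicit Defensive.

Import GRing.Theory Num.Theory.

Local Open Scope ring_scope.

(** * Linear maps and traces *)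

Section LinearMaps.

Variable K : fieldType.
Implicit Types U V W : lmodType K.

Lemma lin0 U V (f : U -> V) : linear f -> f 0 = 0.
Proof. by move=> lf; have := lf (-1) 0 0; rewrite !scaleN1r oppr0 addr0 addNr. Qed.

Lemma linD U V (f : U -> V) x y : linear f -> f (x + y) = f x + f y.
Proof. by move=> lf; have := lf 1 x y; rewrite !scale1r. Qed.

Lemma linZ U V (f : U -> V) c x : linear f -> f (c *: x) = c *: f x.
Proof. by move=> lf; have := lf c x 0; rewrite (lin0 lf) !addr0. Qed.

Lemma linB U V (f : U -> V) x y : linear f -> f (x - y) = f x - f y.
Proof.
by move=> lf; rewrite (linD _ _ lf) -scaleN1r (linZ _ _ lf) scaleN1r.
Qed.

Lemma lin_sum U V (f : U -> V) (I : Type) (r : seq I) (P : pred I) F :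
  linear f -> f (\sum_(i <- r | P i) F i) = \sum_(i <- r | P i) f (F i).
Proof.
move=> lf; elim/big_rec2: _ => [|i y x _ <-]; first exact: lin0.
exact: linD.
Qed.

Lemma lin_id U : linear (fun x : U => x).
Proof. by []. Qed.

Lemma lin_comp U V W (f : V -> W) (g : U -> V) :
  linear f -> linear g -> linear (fun x => f (g x)).
Proof. by move=> lf lg c x y; rewrite lg lf. Qed.

Lemma lin_add U V (f g : U -> V) :
  linear f -> linear g -> linear (fun x => f x + g x).
Proof. by move=> lf lg c x y; rewrite lf lg scalerDr addrACA. Qed.

Lemma lin_opp U V (f : U -> V) : linear f -> linear (fun x => - f x).
Proof. by move=> lf c x y; rewrite lf opprD scalerN. Qed.

Lemma lin_bigsum U V (I : Type) (r : seq I) (P : pred I) (F : U -> I -> V) :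
    (forall i, linear (fun x => F x i)) ->
  linear (fun x => \sum_(i <- r | P i) F x i).
Proof.
move=> lF c x y; rewrite scaler_sumr -big_split.
by apply: eq_bigr => i _; rewrite lF.
Qed.

Lemma lin_scale U V (c : K) (f : U -> V) :
  linear f -> linear (fun x => c *: f x).
Proof. by move=> lf d x y; rewrite lf scalerDr !scalerA mulrC. Qed.

(* Functionals are given the codomain K^o so that [linear] applies to them. *)
Lemma lin_scalel U V (f : U -> K^o) (v : V) :
  linear f -> linear (fun x => (f x : K) *: v).
Proof. by move=> lf c x y; rewrite lf scalerDl scalerA. Qed.

Lemma lin_mull U (A : algType K) (f : U -> A) a :
  linear f -> linear (fun x => f x * a).
Proof. by move=> lf c x y; rewrite lf mulrDl scalerAl. Qed.

Lemma lin_mulr U (A : algType K) (f : U -> A) a :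
  linear f -> linear (fun x => a * f x).
Proof. by move=> lf c x y; rewrite lf mulrDr scalerAr. Qed.

Lemma lin_tensl (U V W : vectType K) (f : U -> V) (w : W) :
  linear f -> linear (fun x => tens (f x) w).
Proof. by move=> lf c x y; rewrite lf tens_linearl. Qed.

Lemma lin_tensr (U V W : vectType K) (f : U -> V) (w : W) :
  linear f -> linear (fun x => tens w (f x)).
Proof. by move=> lf c x y; rewrite lf tens_linearr. Qed.

Lemma lin_hom (U V : vectType K) (f : 'Hom(U, V)) : linear f.
Proof. exact: linearP. Qed.

End LinearMaps.

(** * Traces of functions on finite-dimensional spaces *)

Section Trace.

Variable K : fieldType.
Implicit Types V : vectType K.

(** Taking a bare function instead of an element of ['End(V)] lets lambda terms be traced directly;
    [lftraceE] identifies it with [lftrace]. *)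
Definition ltr V (f : V -> V) : K :=
  \sum_(i < \dim {:V}) coord (vbasis {:V}) i (f (vbasis {:V})`_i).

Lemma coord_vbasisT V (v : V) :
  v = \sum_(i < \dim {:V}) coord (vbasis {:V}) i v *: (vbasis {:V})`_i.
Proof. by apply: coord_vbasis; rewrite memvf. Qed.

Lemma eq_ltr V (f g : V -> V) : f =1 g -> ltr f = ltr g.
Proof. by move=> fg; apply: eq_bigr => i _; rewrite fg. Qed.

Lemma lftraceE V (f : 'End(V)) : lftrace f = ltr f.
Proof.
rewrite /lftrace /mxtrace; apply: eq_bigr => i _.
by rewrite !mxE /= passmx.vecof_delta.
Qed.

(** The trace of the rank-one map [x |-> phi(x) v] is [phi(v)]. Most traces below are computed this
    way. *)
Lemma ltr_rank1 V (I : finType) (phi : I -> V -> K^o) (v : I -> V) f :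
    (forall i, linear (phi i)) -> (forall x, f x = \sum_i (phi i x : K) *: v i) ->
  ltr f = \sum_i (phi i (v i) : K).
Proof.
move=> lphi fE; rewrite /ltr.
under eq_bigr => i _ do rewrite fE linear_sum.
rewrite exchange_big; apply: eq_bigr => j _ /=.
rewrite [in RHS](coord_vbasisT (v j)) (lin_sum _ _ _ (lphi j)).
by apply: eq_bigr => i _; rewrite (linZ _ _ (lphi j)) linearZ; apply: mulrC.
Qed.

Lemma ltrC V (f g : V -> V) : linear f -> linear g ->
  ltr (fun x => f (g x)) = ltr (fun x => g (f x)).
Proof.
move=> lf lg; symmetry.
apply: (@ltr_rank1 _ _ (fun i x => coord (vbasis {:V}) i (f x) : K^o)
  (fun i => g (vbasis {:V})`_i)) => [i|x].
  by move=> c x y; rewrite lf linearP.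
rewrite [in LHS](coord_vbasisT (f x)) (lin_sum _ _ _ lg).
by apply: eq_bigr => i _; rewrite (linZ _ _ lg).
Qed.

Lemma ltrD V (f g : V -> V) : ltr (fun x => f x + g x) = ltr f + ltr g.
Proof. by rewrite /ltr -big_split; apply: eq_bigr => i _; rewrite linearD. Qed.

Lemma ltrZ V c (f : V -> V) : ltr (fun x => c *: f x) = c * ltr f.
Proof. by rewrite /ltr mulr_sumr; apply: eq_bigr => i _; rewrite linearZ. Qed.

Lemma ltr_id V : ltr (fun x : V => x) = (\dim {:V})%:R.
Proof.
rewrite /ltr; under eq_bigr => i _.
  rewrite coord_free ?(basis_free (vbasisP _)) // eqxx; over.
by rewrite sumr_const card_ord.
Qed.

(** In the rank factorization [A = col_base A *m row_base A], idempotence forces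
    [row_base A *m col_base A] to be the identity of size [\rank A]. *)
Lemma mxtrace_idem n (A : 'M[K]_n) : A *m A = A -> \tr A = (\rank A)%:R.
Proof.
move=> AA; rewrite -{1}(mulmx_base A) mxtrace_mulC.
suff -> : row_base A *m col_base A = 1%:M by rewrite mxtrace1.
apply: (row_full_inj (col_base_full A)); rewrite mulmx1.
apply: (row_free_inj (row_base_free A)).
by rewrite mulmx_base mulmxA mulmx_base -mulmxA mulmx_base.
Qed.

Section TraceIdem.

Variable V : vectType K.

Definition lmx (f : V -> V) : 'M[K]_(\dim {:V}) :=
  \matrix_(i, j) coord (vbasis {:V}) j (f (vbasis {:V})`_i).

Lemma ltr_mx (f : V -> V) : ltr f = \tr (lmx f).
Proof. by apply: eq_bigr => i _; rewrite mxE. Qed.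

Lemma lmxM (f g : V -> V) : linear g -> lmx f *m lmx g = lmx (fun x => g (f x)).
Proof.
move=> lg; apply/matrixP => i j; rewrite !mxE.
rewrite [in RHS](coord_vbasisT (f _)) (lin_sum _ _ _ lg) linear_sum.
by apply: eq_bigr => k _; rewrite !mxE (linZ _ _ lg) linearZ.
Qed.

Lemma eq_lmx (f g : V -> V) : f =1 g -> lmx f = lmx g.
Proof. by move=> fg; apply/matrixP => i j; rewrite !mxE fg. Qed.

Lemma lmx_id : lmx (fun x : V => x) = 1%:M.
Proof.
apply/matrixP => i j; rewrite !mxE coord_free //.
exact: basis_free (vbasisP _).
Qed.

Lemma lmx0_eq0 (f : V -> V) : linear f -> lmx f = 0 -> forall x, f x = 0.
Proof.
move=> lf f0 x; rewrite (coord_vbasisT x) (lin_sum _ _ _ lf) big1 // => i _.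
rewrite (linZ _ _ lf) (coord_vbasisT (f _)) big1 ?scaler0 // => j _.
by move/matrixP/(_ i j): f0; rewrite !mxE => ->; rewrite scale0r.
Qed.

Lemma ltr_idem (f : V -> V) : linear f -> (forall x, f (f x) = f x) ->
  ltr f = (\rank (lmx f))%:R.
Proof.
by move=> lf ff; rewrite ltr_mx mxtrace_idem // lmxM //; apply: eq_lmx.
Qed.

End TraceIdem.

End Trace.

(** * Sweedler notation *)

Section Sweedler.

Variables (K : fieldType) (H : hopfAlgType K).

(** [B] is an arbitrary function rather than a bundled bilinear map: linearity is requested only by
    the rules that need it, and exchanging two Sweedler sums is an exchange of finite sums. *)
Definition sw (W : lmodType K) (h : H) (B : H -> H -> W) : W :=
  tlift B (comul h).

End Sweedler.

Notation "\sw_ ( a , b <- h ) E" := (sw h (fun a b => E))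
  (at level 41, E at level 41, a name, b name, h at level 50,
   format "'[' \sw_ ( a ,  b  <-  h ) '/  '  E ']'").

Lemma lin_swl (K : fieldType) (H : hopfAlgType K) (U W : lmodType K)
    (f : U -> H) (B : H -> H -> W) :
  (forall a, linear (B a)) -> linear f -> linear (fun x => sw (f x) B).
Proof.
move=> lB lf c x y; rewrite /sw lf linearP.
exact: (tlift_linear lB).
Qed.

Lemma lin_swr (K : fieldType) (H : hopfAlgType K) (U W : lmodType K)
    (h : H) (B : U -> H -> H -> W) :
  (forall a b, linear (fun x => B x a b)) -> linear (fun x => sw h (B x)).
Proof.
move=> lB c x y; rewrite /sw /tlift scaler_sumr -big_split.
by apply: eq_bigr => i _; rewrite lB.
Qed.

(* A pattern variable ?c could capture the bound variable, so a subterm is tested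
   for being constant by matching its abstraction against (fun _ => ?c). *)
Ltac lin_step :=
  first [ exact (@lin_id _ _) | solve [auto 2 with nocore] | lazymatch goal with
  | |- linear (fun x => \sum_(i <- _ | _) _) => apply: lin_bigsum => ?
  | |- linear (fun x => @?f x * @?g x) =>
      lazymatch g with
      | (fun _ => ?c) => apply (@lin_mull _ _ _ f c)
      | _ => lazymatch f with (fun _ => ?c) => apply (@lin_mulr _ _ _ g c) end
      end
  | |- linear (fun x => @?f x *: @?g x) =>
      lazymatch g with
      | (fun _ => ?c) => apply (@lin_scalel _ _ _ f c)
      | _ => lazymatch f with (fun _ => ?c) => apply (@lin_scale _ _ _ _ g) end
      end
  | |- linear (fun x => @?f x + @?g x) => apply (@lin_add _ _ _ f g)
  | |- linear (fun x => - @?f x) => apply (@lin_opp _ _ _ f)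
  | |- linear (fun x => tens (@?f x) (@?g x)) =>
      lazymatch g with
      | (fun _ => ?c) => apply (@lin_tensl _ _ _ _ f c)
      | _ => lazymatch f with (fun _ => ?c) => apply (@lin_tensr _ _ _ _ g c) end
      end
  | |- linear (fun x => sw (@?f x) (@?B x)) =>
      lazymatch B with
      | (fun _ => ?c) => apply (@lin_swl _ _ _ _ f c)
      | _ => lazymatch f with (fun _ => ?h) => apply (@lin_swr _ _ _ _ h B) end
      end
  | |- linear ( *:%R ?c) => apply (@lin_scale _ _ _ _ (fun x => x))
  | |- linear ( *%R ?c) => apply (@lin_mulr _ _ _ (fun x => x) c)
  | |- linear (tens ?v) => apply (@lin_tensr _ _ _ _ (fun x => x) v)
  | |- linear (fun x => ?F (@?f x)) =>
      apply (@lin_comp _ _ _ _ F f); [first [exact: linearP | idtac] | ]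
  end
  | lazymatch goal with
  | |- linear (fun x => ?G (@?g x) (@?f x)) =>
      lazymatch f with
      | (fun _ => ?c) => apply (@lin_comp _ _ _ _ (fun y => G y c) g)
      end
  end ].

Ltac lin := repeat (intros; cbn beta; lin_step).

Section SweedlerRules.

Variables (K : fieldType) (H : hopfAlgType K).
Implicit Types (W : lmodType K) (h : H).

Lemma eq_sw W h (B B' : H -> H -> W) :
  (forall a b, B a b = B' a b) -> sw h B = sw h B'.
Proof. by move=> BB'; apply: eq_tlift. Qed.

Lemma sw_exch W h k (B : H -> H -> H -> H -> W) :
  \sw_(a, b <- h) \sw_(c, d <- k) B a b c d =
  \sw_(c, d <- k) \sw_(a, b <- h) B a b c d.
Proof. exact: exchange_big. Qed.

Lemma lin_sw W W' (f : W -> W') h (B : H -> H -> W) :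
  linear f -> f (sw h B) = \sw_(a, b <- h) f (B a b).
Proof. exact: linear_tlift. Qed.

Lemma sw_tens h : \sw_(a, b <- h) tens a b = comul h.
Proof. by rewrite [RHS]tens_decomp. Qed.

Lemma sw_tlift W h k (B : H -> H -> W) :
    (forall b, linear (fun a => B a b)) -> (forall a, linear (B a)) ->
  tlift B (comul h * comul k) =
  \sw_(a, b <- h) \sw_(c, d <- k) B (a * c) (b * d).
Proof.
move=> l1 l2.
rewrite -[comul h * comul k]/(tens_mul _ _) /tens_mul.
rewrite (linear_tlift _ _ (tlift_linear l2)); apply: eq_tlift => a b.
rewrite (linear_tlift _ _ (tlift_linear l2)); apply: eq_tlift => c d.
by rewrite tlift_tens.
Qed.

Lemma sw_mul W h k (B : H -> H -> W) :
    (forall b, linear (fun a => B a b)) -> (forall a, linear (B a)) ->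
  sw (h * k) B = \sw_(a, b <- h) \sw_(c, d <- k) B (a * c) (b * d).
Proof. by move=> l1 l2; rewrite -sw_tlift // -rmorphM. Qed.

Lemma sw_one W (B : H -> H -> W) :
    (forall b, linear (fun a => B a b)) -> (forall a, linear (B a)) ->
  sw 1 B = B 1 1.
Proof. by move=> l1 l2; rewrite /sw rmorph1 tlift_tens. Qed.

(** [G] and [G'] are the maps induced by [B] on the two bracketings of the triple tensor product;
    [comulA] matches them. *)
Lemma swA W h (B : H -> H -> H -> W) :
    (forall b c, linear (fun a => B a b c)) ->
    (forall a c, linear (fun b => B a b c)) ->
    (forall a b, linear (B a b)) ->
  \sw_(s, c <- h) \sw_(a, b <- s) B a b c =
  \sw_(a, t <- h) \sw_(b, c <- t) B a b c.
Proof.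
move=> l1 l2 l3.
pose G a (t : tensor H H) := tlift (B a) t.
have Gr a : linear (G a) by exact: tlift_linear.
have Gl t : linear (G^~ t).
  by rewrite /G /tlift; apply: lin_bigsum => i; lin.
have <- : tlift G (tmap id comul (comul h)) =
          \sw_(a, t <- h) \sw_(b, c <- t) B a b c.
  by rewrite tlift_tmap.
rewrite -comulA /tassoc linear_tlift; last exact: tlift_linear.
pose G' (t : tensor H H) c := tlift (fun a b => B a b c) t.
have G'r t : linear (G' t).
  by rewrite /G' /tlift; apply: lin_bigsum => i; lin.
have G'l c : linear (G'^~ c) by apply: tlift_linear => a; lin.
transitivity (tlift G' (tmap comul id (comul h))).
  by rewrite tlift_tmap.
apply: eq_tlift => t c.
rewrite linear_tlift; last exact: tlift_linear.
apply: eq_tlift => a b; rewrite (tlift_tens Gl Gr) /G tlift_tens => [//||]; lin.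
Qed.

Lemma sw_counitl W h (f : H -> W) :
  linear f -> \sw_(a, b <- h) (counit a *: f b) = f h.
Proof.
move=> lf; rewrite -[in RHS](counitl h) linear_tlift //.
by apply: eq_tlift => a b; rewrite linZ.
Qed.

Lemma sw_counitr W h (f : H -> W) :
  linear f -> \sw_(a, b <- h) (counit b *: f a) = f h.
Proof.
move=> lf; rewrite -[in RHS](counitr h) linear_tlift //.
by apply: eq_tlift => a b; rewrite linZ.
Qed.

Lemma sw_antipodel W h (f : H -> W) :
  linear f -> \sw_(a, b <- h) f (antipode a * b) = counit h *: f 1.
Proof.
by move=> lf; rewrite -(lin_sw _ _ lf) [sw _ _]antipodel linZ.
Qed.

Lemma sw_antipoder W h (f : H -> W) :
  linear f -> \sw_(a, b <- h) f (a * antipode b) = counit h *: f 1.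
Proof.
by move=> lf; rewrite -(lin_sw _ _ lf) [sw _ _]antipoder linZ.
Qed.

End SweedlerRules.

(** * The antipode *)

Section Antipode.

Variables (K : fieldType) (H : hopfAlgType K).
Implicit Types (W : lmodType K) (a b h : H).

Lemma antipode1 : antipode (1 : H) = 1.
Proof.
have := sw_antipodel 1 (@lin_id _ H).
rewrite sw_one ?mulr1 ?rmorph1 ?scale1r //; lin.
Qed.

(* Both sides are convolution inverses of the multiplication of H. *)
Lemma antipodeM a b : antipode (a * b) = antipode b * antipode a.
Proof.
pose F (a1 c1 c2 b1 d1 d2 : H) : H :=
  antipode (a1 * b1) * (c1 * d1) * (antipode d2 * antipode c2).
transitivity (\sw_(a1, a2 <- a) \sw_(c1, c2 <- a2)
              \sw_(b1, b2 <- b) \sw_(d1, d2 <- b2) F a1 c1 c2 b1 d1 d2).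
  rewrite -[in LHS](sw_counitr a (@lin_id _ H)).
  rewrite (@lin_sw _ _ _ _ (fun x => antipode (x * b))); last by lin.
  apply: eq_sw => a1 a2.
  transitivity (\sw_(b1, b2 <- b) \sw_(c1, c2 <- a2) \sw_(d1, d2 <- b2)
                  F a1 c1 c2 b1 d1 d2); last first.
    exact: sw_exch.
  rewrite -[in LHS](sw_counitr b (@lin_id _ H)).
  rewrite (@lin_sw _ _ _ _ (fun x => antipode ((_ *: a1) * x))); last by lin.
  apply: eq_sw => b1 b2.
  transitivity (counit a2 *: (counit b2 *: (antipode (a1 * b1)))).
    by rewrite -scalerAl -scalerAr !linearZ /= !scalerA mulrC.
  rewrite /F.
  transitivity (\sw_(c1, c2 <- a2)
    (counit b2 *: (antipode (a1 * b1) * (c1 * antipode c2)))).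
    rewrite (@sw_antipoder _ _ _ a2 (fun x => counit b2 *: (antipode (a1 * b1) * x))).
      by rewrite mulr1.
    lin.
  apply: eq_sw => c1 c2.
  transitivity (\sw_(d1, d2 <- b2)
    antipode (a1 * b1) * (c1 * (d1 * antipode d2) * antipode c2)).
    rewrite (@sw_antipoder _ _ _ b2 (fun x => antipode (a1 * b1) * (c1 * x * antipode c2))).
      by rewrite mulr1.
    lin.
  by apply: eq_sw => d1 d2; rewrite !mulrA.
rewrite -swA; try by rewrite /F; lin.
transitivity (\sw_(s, c2 <- a) \sw_(t, d2 <- b) \sw_(a1, c1 <- s) \sw_(b1, d1 <- t)
                F a1 c1 c2 b1 d1 d2).
  apply: eq_sw => s c2; rewrite [RHS]sw_exch; apply: eq_sw => a1 c1.
  rewrite -swA //; by rewrite /F; lin.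
transitivity (\sw_(s, c2 <- a) (counit s *: (\sw_(t, d2 <- b)
                (counit t *: (antipode d2 * antipode c2))))).
  apply: eq_sw => s c2; rewrite lin_sw; last by lin.
  apply: eq_sw => t d2.
  rewrite -(@sw_mul _ _ _ s t (fun p q => antipode p * q * _)); try by lin.
  rewrite (@sw_antipodel _ _ _ _ (fun x => x * _)); last by lin.
  by rewrite mul1r rmorphM scalerA.
rewrite sw_counitl; last by lin.
rewrite sw_counitl //; by lin.
Qed.

Lemma counit_antipode h : counit (antipode h) = counit h.
Proof.
have lc : linear (fun x : H => counit x : K^o) by move=> c x y; rewrite linearP.
rewrite -[in LHS](sw_counitr h (@lin_id _ H)).
rewrite (@lin_sw _ _ _ K^o (fun x => counit (antipode x))); last first.
  exact: (lin_comp lc (linearP antipode)).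
have := @sw_antipodel _ _ K^o h _ lc; rewrite rmorph1 => sE.
rewrite -[RHS]mulr1 -[RHS]sE; apply: (@eq_sw _ _ K^o) => a b.
by rewrite !linearZ rmorphM /= mulrC.
Qed.

(* Both sides are convolution inverses of the comultiplication. *)
Lemma comul_antipode h :
  comul (antipode h) = \sw_(a, b <- h) tens (antipode b) (antipode a).
Proof.
pose R h := \sw_(a, b <- h) tens (antipode b) (antipode a).
have lR : linear R by rewrite /R; lin.
have lS (k c : H) : linear (fun x => tens (x * antipode k) c) by lin.
have comulR t : \sw_(p, q <- t) (comul p * R q) = counit t *: 1.
  transitivity (\sw_(p, q <- t) \sw_(p1, p2 <- p) \sw_(a, b <- q)
                  tens (p1 * antipode b) (p2 * antipode a)).
    apply: eq_sw => p q; rewrite -sw_tens.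
    rewrite (@lin_sw _ _ _ _ (fun x => x * R q)); last by lin.
    apply: eq_sw => p1 p2; rewrite /R lin_sw; last by lin.
    by apply: eq_sw => a b; rewrite -[LHS]/(tens_mul _ _) tens_mulE.
  rewrite (@swA _ _ _ t (fun p1 p2 q => \sw_(a, b <- q)
             tens (p1 * antipode b) (p2 * antipode a))); try by lin.
  transitivity (\sw_(p1, u <- t) tens (p1 * antipode u) (1 : H)); last first.
    rewrite (@sw_antipoder _ _ _ t (fun x => tens x 1)) //; lin.
  apply: eq_sw => p1 u.
  rewrite -(@swA _ _ _ u (fun p2 a b => tens (p1 * antipode b) (p2 * antipode a))); try by lin.
  transitivity (\sw_(v, b <- u) (counit v *: tens (p1 * antipode b) (1 : H))).
    apply: eq_sw => v b.
    rewrite (@sw_antipoder _ _ _ v (fun x => tens _ x)) //; lin.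
  by rewrite (@sw_counitl _ _ _ _ (fun b => tens (p1 * antipode b) (1 : H))) //; lin.
transitivity (\sw_(h1, t <- h) \sw_(p, q <- t)
                (comul (antipode h1) * (comul p * R q))).
  transitivity (\sw_(h1, t <- h) (counit t *: comul (antipode h1))).
    by rewrite (@sw_counitr _ _ _ _ (fun x => comul (antipode x))) //; lin.
  apply: eq_sw => h1 t; rewrite -lin_sw; last by lin.
  by rewrite comulR -scalerAr mulr1.
rewrite -swA; try by lin.
transitivity (\sw_(s, q <- h) (counit s *: R q)); last by rewrite sw_counitl.
apply: eq_sw => s q.
transitivity (\sw_(h1, p <- s) (comul (antipode h1 * p) * R q)).
  by apply: eq_sw => h1 p; rewrite rmorphM mulrA.
rewrite (@sw_antipodel _ _ _ _ (fun x => comul x * R q)); last by lin.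
by rewrite rmorph1 mul1r.
Qed.

Lemma sw_antipode W h (B : H -> H -> W) :
    (forall b, linear (fun a => B a b)) -> (forall a, linear (B a)) ->
  sw (antipode h) B = \sw_(a, b <- h) B (antipode b) (antipode a).
Proof.
move=> l1 l2; rewrite [LHS]/sw comul_antipode.
rewrite (@lin_sw _ _ _ _ (tlift B)); last exact: tlift_linear.
by apply: eq_sw => a b; rewrite tlift_tens.
Qed.

Lemma sw_antipode2 W h (B : H -> H -> W) :
    (forall b, linear (fun a => B a b)) -> (forall a, linear (B a)) ->
  sw (antipode (antipode h)) B =
  \sw_(a, b <- h) B (antipode (antipode a)) (antipode (antipode b)).
Proof. by move=> l1 l2; rewrite sw_antipode // sw_antipode //; lin. Qed.

End Antipode.

(** * Integrals and the Frobenius form *)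

Section Integral.

Variables (K : fieldType) (H : hopfAlgType K).
Implicit Types (W : lmodType K) (a b h x y : H).
Local Notation S := (@antipode K H).

Lemma linS : linear S. Proof. exact: linearP. Qed.
Lemma linSS : linear (fun x => S (S x)).
Proof. exact: (lin_comp linS linS). Qed.

Definition lam h : K^o := ltr (fun x : H => S (S x) * h).

Lemma lin_lam : linear lam.
Proof.
move=> c x y; rewrite /lam /ltr scaler_sumr -big_split; apply: eq_bigr => i _.
by rewrite mulrDr -scalerAr linearP.
Qed.

(** Expanding the coproduct of [S^2(b_1) h] leaves [S(b_3) S^2(b_2) = S(S(b_2) b_3)], which
    collapses by the antipode axiom. *)
Lemma lam_right_aux (th : H -> K^o) b h : linear th ->
  \sw_(h1, h2 <- h) ((th (S (S b) * h1) : K) *: h2) =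
  \sw_(b1, b2 <- b) \sw_(z1, z2 <- S (S b1) * h) ((th z1 : K) *: (S b2 * z2)).
Proof.
move=> lth; symmetry.
transitivity (\sw_(b1, b2 <- b) \sw_(p, q <- b1) \sw_(h1, h2 <- h)
    ((th (S (S p) * h1) : K) *: (S b2 * (S (S q) * h2)))).
  apply: eq_sw => b1 b2; rewrite sw_mul; try by lin.
  by rewrite sw_antipode2; try by lin.
rewrite swA; try by lin.
transitivity (\sw_(p, t <- b)
   (counit t *: \sw_(h1, h2 <- h) ((th (S (S p) * h1) : K) *: h2))).
  apply: eq_sw => p t; rewrite sw_exch lin_sw; last by lin.
  apply: eq_sw => h1 h2.
  transitivity (\sw_(q, b2 <- t) ((th (S (S p) * h1) : K) *: (S (S q * b2) * h2))).
    by apply: eq_sw => q b2; rewrite antipodeM mulrA.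
  rewrite (@sw_antipodel _ _ _ _ (fun x => (th (S (S p) * h1) : K) *: (S x * h2))); last by lin.
  by rewrite antipode1 mul1r.
rewrite (@sw_counitr _ _ _ _ (fun p => \sw_(h1, h2 <- h) ((th (S (S p) * h1) : K) *: h2))) //; lin.
Qed.

(** The auxiliary identity is summed over [b = e_i] with [th] the i-th coordinate. A change of dual
    basis moves the coproduct from the basis vectors to [z1], and [S v * z2] then cancels. *)
Lemma lam_right h : \sw_(a, b <- h) ((lam a : K) *: b) = (lam h : K)%:A.
Proof.
pose e := vbasis {:H}; pose co i x : K^o := coord e i x.
have lco i : linear (co i) by exact: linearP.
transitivity (\sum_(i < \dim {:H})
    \sw_(a, b <- h) ((co i (S (S e`_i) * a) : K) *: b)).
  rewrite [RHS]exchange_big; apply: eq_bigr => j _ /=.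
  by rewrite scaler_suml.
transitivity (\sum_(j < \dim {:H}) \sw_(z1, z2 <- S (S e`_j) * h)
                \sw_(u, v <- z1) ((co j u : K) *: (S v * z2))).
  under eq_bigr => i _ do rewrite lam_right_aux //.
  rewrite [LHS]exchange_big; apply: eq_bigr => j _ /=.
  (* [cc x] applies [coord e j] to the first leg of [comul x]; summing [coord e i z1] times [cc e_i]
     over [i] returns [cc z1]. *)
  pose cc x : H := fun_of_lfun (comul x) (linfun (coord e j : H -> K^o)).
  have lcc : linear cc.
    by move=> c x y; rewrite /cc linearP add_lfunE scale_lfunE.
  rewrite [LHS]exchange_big; apply: eq_bigr => i _ /=.
  set z1 := e`_i; set z2 := fun_of_lfun _ _.
  transitivity (S (cc z1) * z2).
    rewrite [in RHS](coord_vbasisT z1) (lin_sum _ _ _ lcc) linear_sum mulr_suml.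
    by apply: eq_bigr => k _; rewrite (linZ _ _ lcc) linearZ -scalerAl.
  rewrite /sw /tlift (bigD1 j) //= big1 ?addr0 => [|k kj].
    by rewrite /co coord_free ?(basis_free (vbasisP _)) // eqxx scale1r.
  by rewrite /co coord_free ?(basis_free (vbasisP _)) // (negPf kj) scale0r.
rewrite /lam /ltr scaler_suml; apply: eq_bigr => j _.
rewrite swA; try by lin.
transitivity (\sw_(u, t <- S (S e`_j) * h) (counit t *: ((co j u : K) *: (1 : H)))).
  apply: eq_sw => u t.
  rewrite (@sw_antipodel _ _ _ _ (fun x => (co j u : K) *: x)) //; lin.
by rewrite (@sw_counitr _ _ _ _ (fun u => (co j u : K) *: (1 : H))) //; lin.
Qed.

(** Cyclicity of the trace and multiplicativity of [S^2]: the square of the antipode acts as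
    Nakayama automorphism of [lam]. *)
Lemma lamC x y : lam (x * y) = lam (S (S y) * x).
Proof.
pose f (z : H) := S (S z) * x.
have lf : linear f by rewrite /f; have := linSS; lin.
suff : ltr (fun z => S (S z) * (x * y)) = ltr (fun z => S (S z) * (S (S y) * x)).
  by [].
transitivity (ltr (fun z : H => f z * y)).
  by apply: eq_ltr => z; rewrite /f mulrA.
rewrite (@ltrC _ _ (fun z => z * y)) //; last by lin.
by apply: eq_ltr => z; rewrite /f !antipodeM mulrA.
Qed.

Lemma lam_SS x : lam (S (S x)) = lam x.
Proof. by have := lamC 1 x; rewrite mul1r mulr1. Qed.

(** Insert [h_2 S(h_3)] to the right of [x_2], recognise the coproduct of [x h_1], and apply
    [lam_right] to it. *)
Lemma lam_mul_antipode x h :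
  \sw_(x1, x2 <- x) ((lam (x1 * h) : K) *: x2) =
  \sw_(a, b <- h) ((lam (x * a) : K) *: S b).
Proof.
have llam := lin_lam.
transitivity (\sw_(a, r <- h) \sw_(q, b <- r) \sw_(x1, x2 <- x)
                ((lam (x1 * a) : K) *: (x2 * (q * S b)))).
  transitivity (\sw_(a, r <- h) (counit r *: \sw_(x1, x2 <- x) ((lam (x1 * a) : K) *: x2))).
    rewrite (@sw_counitr _ _ _ _ (fun a => \sw_(x1, x2 <- x) ((lam (x1 * a) : K) *: x2))) //; lin.
  apply: eq_sw => a r; rewrite [RHS]sw_exch lin_sw; last by lin.
  apply: eq_sw => x1 x2.
  rewrite (@sw_antipoder _ _ _ _ (fun y => (lam (x1 * a) : K) *: (x2 * y))); last by lin.
  by rewrite mulr1.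
rewrite -swA; try by lin.
transitivity (\sw_(s, b <- h) \sw_(p, q <- x * s) ((lam p : K) *: (q * S b))).
  apply: eq_sw => s b; rewrite sw_mul; try by lin.
  rewrite [RHS]sw_exch.
  by apply: eq_sw => x1 x2; apply: eq_sw => p q; rewrite mulrA.
apply: eq_sw => s b.
transitivity ((\sw_(p, q <- x * s) ((lam p : K) *: q)) * S b).
  rewrite (@lin_sw _ _ _ _ (fun y => y * S b)); last by lin.
  by apply: eq_sw => p q; rewrite scalerAl.
by rewrite lam_right -scalerAl mul1r.
Qed.

Variable L : H.
Hypotheses (intL : integral L) (epsL : counit L = 1).

(** Since [S^2(x) L = counit(x) L], the traced map has rank one. *)
Lemma lam_integral : lam L = 1.
Proof.
have lc : linear (counit : H -> K^o) by move=> c x y; rewrite linearP.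
rewrite /lam (@ltr_rank1 _ _ _ (fun (_ : 'I_1) x => counit x : K^o) (fun=> L)) => [|//|x].
  by rewrite big_ord1.
by rewrite big_ord1 (intL _).1 !counit_antipode.
Qed.

(** [L_1] and [S(L_2)] are dual bases for the Frobenius form [lam]: take [h = L] in
    [lam_mul_antipode] and use [x_1 L = counit(x_1) L]. *)
Lemma dual_bases x : \sw_(a, b <- L) ((lam (x * a) : K) *: S b) = x.
Proof.
have llam := lin_lam.
transitivity (\sw_(x1, x2 <- x) ((lam (x1 * L) : K) *: x2)); last first.
  rewrite -[RHS](sw_counitl x (@lin_id _ H)); apply: eq_sw => a b.
  rewrite (intL _).1 (linZ _ _ llam) lam_integral.
  by congr (_ *: _); apply: mulr1.
by rewrite lam_mul_antipode.
Qed.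

Lemma antipode_surj x : exists y, S y = x.
Proof.
exists (\sw_(a, b <- L) ((lam (x * a) : K) *: b)).
rewrite lin_sw; last exact: linS.
by rewrite -[RHS]dual_bases; apply: eq_sw => a b; rewrite linearZ.
Qed.

Lemma antipode_inj : injective S.
Proof.
pose f : 'End(H) := linfun S.
have fE x : f x = S x by rewrite lfunE.
have : limg f = fullv.
  apply/eqP; rewrite eqEsubv subvf; apply/subvP => x _.
  by have [y <-] := antipode_surj x; rewrite -fE memv_img ?memvf.
move=> imf; have /lker0P fI : lker f == 0%VS.
  by rewrite -dimv_eq0 -(eqn_add2r (\dim (limg f))) -{1}(capfv (lker f)) limg_ker_dim imf.
by move=> x y; rewrite -!fE; apply: fI.
Qed.

Lemma lam_nondegl x : (forall a, lam (x * a) = 0) -> x = 0.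
Proof.
move=> x0; rewrite -[LHS]dual_bases /sw /tlift big1 // => i _.
by rewrite x0 scale0r.
Qed.

Lemma antipode_integral : S L = L.
Proof.
apply: integral_uniq => //; last by rewrite counit_antipode.
move=> h; have [k <-] := antipode_surj h.
by rewrite -!antipodeM (intL k).1 (intL k).2 linearZ counit_antipode.
Qed.

Lemma ltr_dual_bases (f : H -> H) :
  linear f -> ltr f = \sw_(a, b <- L) lam (f (S b) * a).
Proof.
move=> lf; have llam := lin_lam.
pose e := vbasis {:H}.
pose cc i : H := fun_of_lfun (comul L) (linfun (coord e i : H -> K^o)).
suff : ltr f = \sum_(i < \dim {:H}) (lam (f (S (cc i)) * e`_i) : K) by [].
rewrite (@ltr_rank1 _ _ _ (fun (i : 'I_(\dim {:H})) x => lam (x * e`_i))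
  (fun i => f (S (cc i)))) // => [i|x]; first by lin.
rewrite -[x in LHS]dual_bases (lin_sum _ _ _ lf); apply: eq_bigr => i _.
by rewrite (linZ _ _ lf).
Qed.

End Integral.

(** * The regular trace and its nondegeneracy *)

Section RegularTrace.

Variables (K : fieldType) (H : hopfAlgType K).
Implicit Types (a b h x y : H).
Local Notation S := (@antipode K H).

Lemma linfunE (U V : vectType K) (f : U -> V) : linear f -> linfun f =1 f.
Proof.
move=> lf; pose fL : {linear _ -> _} :=
  HB.pack f (GRing.isLinear.Build _ _ _ _ f lf).
exact: (lfunE fL).
Qed.

Definition trl h : K^o := ltr (fun x : H => h * x).

Definition trr h : K^o := ltr (fun x : H => x * h).

Lemma lin_trl : linear trl.
Proof.
move=> c x y; rewrite /trl /ltr scaler_sumr -big_split; apply: eq_bigr => i _.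
by rewrite mulrDl -scalerAl linearP.
Qed.

Lemma lin_trr : linear trr.
Proof.
move=> c x y; rewrite /trr /ltr scaler_sumr -big_split; apply: eq_bigr => i _.
by rewrite mulrDr -scalerAr linearP.
Qed.

Lemma trlC x y : trl (x * y) = trl (y * x).
Proof.
suff : ltr (fun z => x * y * z) = ltr (fun z => y * x * z) by [].
transitivity (ltr (fun z : H => x * (y * z))).
  by apply: eq_ltr => z; rewrite mulrA.
rewrite (@ltrC _ _ (fun z => x * z) (fun z => y * z)); try by lin.
by apply: eq_ltr => z; rewrite mulrA.
Qed.

Lemma trrC x y : trr (x * y) = trr (y * x).
Proof.
suff : ltr (fun z => z * (x * y)) = ltr (fun z => z * (y * x)) by [].
transitivity (ltr (fun z : H => (z * x) * y)).
  by apply: eq_ltr => z; rewrite mulrA.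
rewrite (@ltrC _ _ (fun z => z * y) (fun z => z * x)); try by lin.
by apply: eq_ltr => z; rewrite mulrA.
Qed.

Lemma trl_idem f : f * f = f -> trl f = (\rank (lmx (fun x : H => f * x)))%:R.
Proof.
move=> ff; rewrite /trl (ltr_idem (f := fun x => f * x)) //; first by lin.
by move=> x; rewrite mulrA ff.
Qed.

Hypothesis char0 : [pchar K] =i pred0.

Lemma natr_eq0_char0 n : (n%:R == 0 :> K) = (n == 0)%N.
Proof. exact: (pcharf0P K).1. Qed.

Lemma trl_idem_eq0 f : f * f = f -> trl f = 0 -> f = 0.
Proof.
move=> ff; rewrite trl_idem // => /eqP.
rewrite natr_eq0_char0 mxrank_eq0 => /eqP l0.
rewrite -[f]mulr1; apply: (lmx0_eq0 _ l0); lin.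
Qed.

Hypothesis ssH : semisimple H.

(** The radical [I] of the trace form is a left ideal with complement [J]. The component [f] of [1]
    in [I] is an idempotent of trace zero, hence zero, so [1] lies in [J] and [I = 0]. *)
Lemma trl_nondeg a : (forall b, trl (b * a) = 0) -> a = 0.
Proof.
move=> a0; have ltrl := lin_trl.
pose g (x : H) : 'Hom(H, K^o) := linfun (fun b => trl (b * x)).
have gE x b : g x b = trl (b * x) by rewrite linfunE //; lin.
have lg : linear g.
  move=> c x y; apply/lfunP => b; rewrite add_lfunE scale_lfunE !gE.
  by rewrite mulrDr -scalerAr ltrl.
pose I := lker (linfun g).
have IP x : reflect (forall b, trl (b * x) = 0) (x \in I).
  rewrite memv_ker linfunE //; apply: (iffP eqP) => [gx0 b | x0].
    by rewrite -gE gx0 zero_lfunE.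
  by apply/lfunP => b; rewrite gE x0 zero_lfunE.
have lI : left_ideal I.
  by move=> b x /IP x0; apply/IP => c; rewrite mulrA x0.
have [J [lJ IJ1 IJ0]] := ssH lI.
have /memv_addP[f fI [f' f'J def1]] : 1 \in (I + J)%VS by rewrite IJ1 memvf.
have ff : f * f = f.
  apply/eqP; rewrite -subr_eq0 -memv0 -IJ0 memv_cap rpredB ?lI //=.
  rewrite -opprB rpredN -[X in X - _]mulr1 -mulrBr def1 addrC addKr.
  exact: lJ.
have f0 : f = 0.
  by apply: trl_idem_eq0 => //; have /IP/(_ 1) := fI; rewrite mul1r.
apply/eqP; rewrite -memv0 -IJ0 memv_cap -{2}[a]mulr1 def1 f0 add0r lJ // andbT.
exact/IP.
Qed.

End RegularTrace.

(** * The square and the fourth power of the antipode *)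

Section Modular.

Variables (K : fieldType) (H : hopfAlgType K).
Implicit Types (W : lmodType K) (a b h x y : H).
Local Notation S := (@antipode K H).
Local Notation lam := (@lam K H).

Variable L : H.
Hypotheses (intL : integral L) (epsL : counit L = 1).

Lemma lin_counit : linear (counit : H -> K^o).
Proof. by move=> c x y; rewrite linearP. Qed.

(** Inserting [h_2 S(h_3)] to the right of [b] produces the coproduct of [L s] for a leg [s] of [h],
    and [L s = counit(s) L]. *)
Lemma sw_integral_mul W h (B : H -> H -> W) :
    (forall b, linear (fun a => B a b)) -> (forall a, linear (B a)) ->
  \sw_(a, b <- L) B (a * h) b = \sw_(a, b <- L) B a (b * S h).
Proof.
move=> l1 l2; have leps := lin_counit.
transitivity (\sw_(h1, r <- h) \sw_(h2, h3 <- r) \sw_(a, b <- L)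
                B (a * h1) (b * (h2 * S h3))).
  transitivity (\sw_(h1, r <- h) (counit r *: \sw_(a, b <- L) B (a * h1) b)).
    by rewrite (@sw_counitr _ _ _ _ (fun y => \sw_(a, b <- L) B (a * y) b)) //; lin.
  apply: eq_sw => h1 r; rewrite [RHS]sw_exch lin_sw; last by lin.
  apply: eq_sw => a b.
  rewrite (@sw_antipoder _ _ _ _ (fun y => B (a * h1) (b * y))); last by lin.
  by rewrite mulr1.
rewrite -swA; try by lin.
transitivity (\sw_(s, h3 <- h) (counit s *: \sw_(a, b <- L) B a (b * S h3))).
  apply: eq_sw => s h3.
  transitivity (\sw_(p, q <- L * s) B p (q * S h3)).
    rewrite sw_mul; try by lin.
    rewrite [RHS]sw_exch; apply: eq_sw => h1 h2.
    by apply: eq_sw => a b; rewrite mulrA.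
  rewrite (intL s).2 (@linZ _ _ _ (fun y => \sw_(p, q <- y) B p (q * S h3))) //.
  by lin.
by rewrite (@sw_counitl _ _ _ _ (fun y => \sw_(a, b <- L) B a (b * S y))) //; lin.
Qed.

Definition drinfeld : H := \sw_(a, b <- L) (S b * a).
Local Notation w := drinfeld.

Lemma drinfeld_comm h : w * h = S (S h) * w.
Proof.
rewrite /w (@lin_sw _ _ _ _ (fun y => y * h)); last by lin.
rewrite (@lin_sw _ _ _ _ (fun y => S (S h) * y)); last by lin.
transitivity (\sw_(a, b <- L) (S b * (a * h))).
  by apply: eq_sw => a b; rewrite mulrA.
rewrite (@sw_integral_mul _ h (fun a b => S b * a)); try by lin.
by apply: eq_sw => a b; rewrite antipodeM mulrA.
Qed.

Lemma trl_lam x : trl x = lam (x * w).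
Proof.
have llam := @lin_lam K H.
rewrite /trl (ltr_dual_bases intL epsL); last by lin.
rewrite /w [RHS](@lin_sw _ _ _ K^o (fun y => lam (x * y))); last by lin.
by apply: (@eq_sw _ _ K^o) => a b; rewrite mulrA.
Qed.

(** Cyclicity turns [S(b) a] into [a S(b)], whose Sweedler sum over [L] is [counit(L) = 1]. *)
Lemma trl_drinfeld_central e : (forall x, e * x = x * e) -> trl (w * e) = trl e.
Proof.
move=> eC; have ltrl := @lin_trl K H.
rewrite (@lin_sw _ _ _ K^o (fun y => trl (y * e))); last by lin.
transitivity (\sw_(a, b <- L) trl (e * (a * S b)) : K^o).
  by apply: (@eq_sw _ _ K^o) => a b; rewrite -mulrA -eC trlC mulrA.
rewrite (@sw_antipoder _ _ K^o _ (fun y => trl (e * y))); last by lin.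
by rewrite epsL mulr1 scale1r.
Qed.

(** By [trl_lam], [x w = 0] makes [trl (b * x)] vanish for all [b], so right multiplication by [w]
    is injective, hence onto; the resulting left inverse is two-sided. *)
Lemma drinfeld_unit (char0 : [pchar K] =i pred0) (ssH : semisimple H) :
  w \is a GRing.unit.
Proof.
have injw x : x * w = 0 -> x = 0.
  move=> xw; apply: (trl_nondeg char0 ssH) => b.
  by rewrite trl_lam -mulrA xw mulr0 (lin0 (@lin_lam K H)).
have : limg (amulr w) = fullv.
  apply/eqP; rewrite eqEdim subvf /= -{1}(limg_ker_dim (amulr w) fullv).
  rewrite capfv (_ : lker _ = 0%VS) ?dimv0 //.
  apply/eqP/lker0P => x y; rewrite !lfunE /= => xy.
  by apply/eqP; rewrite -subr_eq0; apply/eqP/injw; rewrite mulrBl xy subrr.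
move=> imw; have /memv_imgP[v _] : 1 \in limg (amulr w) by rewrite imw memvf.
rewrite lfunE /= => vw; apply/unitrP; exists v; split => //.
by apply/eqP; rewrite -subr_eq0; apply/eqP/injw;
  rewrite mulrBl -mulrA -vw mulr1 mul1r subrr.
Qed.

Definition left_int (mu : H -> K^o) : Prop :=
  forall h, \sw_(a, b <- h) ((mu b : K) *: a) = (mu h : K)%:A.

Definition right_int (mu : H -> K^o) : Prop :=
  forall h, \sw_(a, b <- h) ((mu a : K) *: b) = (mu h : K)%:A.

Lemma left_int_antipode (nu : H -> K^o) :
  linear nu -> right_int nu -> left_int (fun x => nu (S x)).
Proof.
move=> lnu rnu h; apply: (antipode_inj intL epsL).
rewrite linearZ /= antipode1 -rnu sw_antipode; try by lin.
rewrite lin_sw; last by exact: linearP.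
by apply: eq_sw => a b; rewrite linearZ.
Qed.

(** The difference [psi] is a left integral vanishing at [L], so [psi(L_2) L_1 = 0]; writing [x] as
    [lam(S(x) L_1) L_2] turns [psi(x)] into [lam] of [S(x)] times that zero. *)
Lemma left_int_uniq (mu : H -> K^o) : linear mu -> left_int mu ->
  forall x, mu x = mu L * lam (S x).
Proof.
move=> lmu imu x; have llam := @lin_lam K H.
have lS : linear S by exact: linearP.
have ilam := left_int_antipode llam (@lam_right K H).
pose psi y : K^o := mu y - mu L * lam (S y).
have lpsi : linear psi.
  by apply: lin_add => //; apply: lin_opp; apply: (@lin_scale _ _ K^o); lin.
have psiL : \sw_(a, b <- L) ((psi b : K) *: a) = 0.
  transitivity (\sw_(a, b <- L) ((mu b : K) *: a) -
                (mu L : K) *: \sw_(a, b <- L) ((lam (S b) : K) *: a)).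
    rewrite /sw /tlift scaler_sumr -sumrB; apply: eq_bigr => i _.
    by rewrite scalerBl scalerA.
  rewrite imu ilam antipode_integral // lam_integral // scalerA mulr1.
  by rewrite subrr.
apply/eqP; rewrite -subr_eq0; apply/eqP; rewrite -/(psi x).
have -> : x = \sw_(a, b <- L) ((lam (S x * a) : K) *: b).
  apply: (antipode_inj intL epsL); rewrite lin_sw //.
  by rewrite -[LHS](dual_bases intL epsL); apply: eq_sw => a b; rewrite linearZ.
rewrite (@lin_sw _ _ _ _ psi) //.
have <- : lam (S x * \sw_(a, b <- L) ((psi b : K) *: a)) = 0.
  by rewrite psiL mulr0 (lin0 llam).
rewrite (@lin_sw _ _ _ K^o (fun y => lam (S x * y))); last by lin.
apply: (@eq_sw _ _ K^o) => a b.
by rewrite (linZ _ _ lpsi) -scalerAr (linZ _ _ llam); apply: mulrC.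
Qed.

Lemma right_int_uniq (nu : H -> K^o) : linear nu -> right_int nu ->
  forall x, nu x = nu L * lam x.
Proof.
move=> lnu rnu x; have [y <-] := antipode_surj intL epsL x.
have lS : linear S by exact: linearP.
rewrite (left_int_uniq _ (left_int_antipode lnu rnu)); last by lin.
by rewrite antipode_integral.
Qed.

(* Up to inversion, the distinguished grouplike element of H. *)
Definition modular : H := \sw_(a, b <- L) ((lam (S a) : K) *: b).
Local Notation g := modular.

(** For each functional [phi], the map [y |-> lam(S(y_1)) phi(y_2)] is a left integral, hence a
    multiple of [lam \o S]; the factor is its value at [L], namely [phi(g)]. *)
Lemma lam_modular x : \sw_(a, b <- x) ((lam (S a) : K) *: b) = (lam (S x) : K) *: g.
Proof.
have llam := @lin_lam K H; have lS : linear S by exact: linearP.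
have ilam := left_int_antipode llam (@lam_right K H).
suff E (phi : H -> K^o) : linear phi ->
    phi (\sw_(a, b <- x) ((lam (S a) : K) *: b)) = phi ((lam (S x) : K) *: g).
  rewrite [LHS]coord_vbasisT [RHS]coord_vbasisT; apply: eq_bigr => i _.
  by congr (_ *: _); apply: (E (coord (vbasis {:H}) i : H -> K^o)); exact: linearP.
move=> lphi.
pose mu y : K^o := \sw_(a, b <- y) ((lam (S a) : K) *: phi b).
have lmu : linear mu by rewrite /mu; lin.
have imu : left_int mu.
  move=> h.
  transitivity (\sw_(h1, t <- h) \sw_(a, b <- t) (((lam (S a) : K) * (phi b : K)) *: h1)).
    apply: eq_sw => h1 t.
    by rewrite (@lin_sw _ _ _ _ (fun c : K^o => (c : K) *: h1)) //; lin.
  rewrite -(@swA _ _ _ h (fun h1 a b => ((lam (S a) : K) * (phi b : K)) *: h1)).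
  - rewrite (@lin_sw _ _ _ _ (fun c : K^o => (c : K) *: (1 : H))); last by lin.
    apply: eq_sw => s b; rewrite -[X in _ = X *: _]mulrC -scalerA -ilam.
    rewrite (@lin_sw _ _ _ _ (fun y => (phi b : K) *: y)); last by lin.
    by apply: eq_sw => a c; rewrite scalerA mulrC.
  - by move=> *; lin.
  - by move=> a c; apply: lin_scalel; apply: lin_mull; lin.
  - by move=> a c; apply: lin_scalel; apply: lin_mulr; lin.
have E y : phi (\sw_(a, b <- y) ((lam (S a) : K) *: b)) = mu y.
  by rewrite lin_sw //; apply: (@eq_sw _ _ K^o) => a b; rewrite linZ.
rewrite E (left_int_uniq lmu imu) (linZ _ _ lphi) /g E.
exact: mulrC.
Qed.

Lemma counit_modular : counit g = 1.
Proof.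
have llam := @lin_lam K H; have lS : linear S by exact: linearP.
have leps := lin_counit.
rewrite /g (@lin_sw _ _ _ K^o counit) //.
rewrite -(lam_integral intL epsL) -[in RHS](antipode_integral intL epsL).
rewrite -[RHS](@sw_counitr _ _ _ _ (fun x => lam (S x))); last by lin.
apply: (@eq_sw _ _ K^o) => a b; rewrite linearZ; exact: mulrC.
Qed.

(** After coassociativity, [lam_modular] contracts the first two legs to a multiple of [g], leaving
    the sum that defines the second copy of [g]. *)
Lemma comul_modular : comul g = tens g g.
Proof.
have llam := @lin_lam K H; have lS : linear S by exact: linearP.
have lcom : linear (comul : H -> tensor H H) by exact: linearP.
rewrite {1}/g (@lin_sw _ _ _ _ comul) //.
transitivity (\sw_(a, r <- L) \sw_(p, q <- r) ((lam (S a) : K) *: tens p q)).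
  apply: eq_sw => a r; rewrite (linZ _ _ lcom) -sw_tens.
  by apply: (@lin_sw _ _ _ _ (fun t : tensor H H => (lam (S a) : K) *: t)); lin.
transitivity (\sw_(s, q <- L) \sw_(a, p <- s) ((lam (S a) : K) *: tens p q)).
  by symmetry; apply: (@swA _ _ _ L (fun a p q => (lam (S a) : K) *: tens p q)); lin.
transitivity (\sw_(s, q <- L) ((lam (S s) : K) *: tens g q)).
  apply: eq_sw => s q.
  transitivity (tens ((lam (S s) : K) *: g) q); last first.
    by rewrite (@linZ _ _ _ (fun y => tens y q)) //; lin.
  rewrite -lam_modular (@lin_sw _ _ _ _ (fun y => tens y q)); last by lin.
  by apply: eq_sw => a p; rewrite (@linZ _ _ _ (fun y => tens y q)) //; lin.
rewrite -{3}/g [in RHS]/g [RHS](@lin_sw _ _ _ _ (tens _)); last by lin.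
apply: eq_sw => s q; rewrite (@linZ _ _ _ (tens _)) //; lin.
Qed.

Lemma sw_modular W (B : H -> H -> W) :
    (forall b, linear (fun a => B a b)) -> (forall a, linear (B a)) ->
  sw g B = B g g.
Proof. by move=> l1 l2; rewrite /sw comul_modular tlift_tens. Qed.

Lemma antipode_modularl : S g * g = 1.
Proof.
have := @sw_antipodel _ _ _ g _ (@lin_id _ H).
by rewrite sw_modular ?counit_modular ?scale1r //; lin.
Qed.

Lemma antipode_modularr : g * S g = 1.
Proof.
have := @sw_antipoder _ _ _ g _ (@lin_id _ H).
by rewrite sw_modular ?counit_modular ?scale1r //; lin.
Qed.

Lemma antipode2_modular : S (S g) = g.
Proof.
rewrite -[LHS]mulr1 -antipode_modularl mulrA -antipodeM antipode_modularr.
by rewrite antipode1 mul1r.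
Qed.

(** The left side is a right integral in [x] with value 1 at [L], so uniqueness identifies it with
    [lam]. *)
Lemma lam_antipode_modular x : lam (S (x * g)) = lam x.
Proof.
have llam := @lin_lam K H; have lS : linear S by exact: linearP.
pose nu y : K^o := lam (S (y * g)).
have lnu : linear nu by rewrite /nu; lin.
have rnu : right_int nu.
  move=> h; rewrite /nu.
  transitivity ((\sw_(a, b <- h * g) ((lam (S a) : K) *: b)) * S g).
    rewrite sw_mul; try by lin.
    rewrite (@lin_sw _ _ _ _ (fun y => y * S g)); last by lin.
    apply: eq_sw => a b; rewrite sw_modular; try by lin.
    by rewrite -scalerAl -mulrA antipode_modularr mulr1.
  by rewrite lam_modular -scalerAl antipode_modularr.
rewrite -/(nu x) (right_int_uniq lnu rnu) /nu (intL g).2 counit_modular scale1r.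
by rewrite antipode_integral // lam_integral // mul1r.
Qed.

(* Radford's formula: lam and lam \o S have the Nakayama automorphisms S^2 and
   S^-2, and lam h = lam (S (h * g)). *)
Lemma antipode4 a : S (S (S (S a))) = S g * a * g.
Proof.
suff E : g * S (S (S (S a))) * S g = a.
  by rewrite -[in RHS]E !mulrA antipode_modularl mul1r -mulrA antipode_modularl mulr1.
apply/eqP; rewrite -subr_eq0; apply/eqP; apply: (lam_nondegl intL epsL) => b.
rewrite mulrBl (linB _ _ (@lin_lam K H)); apply/eqP; rewrite subr_eq0; apply/eqP.
rewrite -[RHS]lam_antipode_modular.
have -> : lam (S (a * b * g)) = lam (S (b * (g * S (S a) * S g) * g)).
  have -> : b * (g * S (S a) * S g) * g = b * g * S (S a).
    by rewrite !mulrA -(mulrA _ (S g)) antipode_modularl mulr1.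
  by rewrite -mulrA antipodeM lamC -antipodeM.
by rewrite lam_antipode_modular lamC !antipodeM !antipode2_modular.
Qed.

End Modular.

(** [m] is the first exponent at which [x^m v] depends on the lower powers. Used with [v = 1] for
    grouplike elements and with [v] an idempotent for the minimal polynomial on a block. *)
Lemma powers_dep (K : fieldType) (A : falgType K) (x v : A) : v != 0 ->
  exists m (X : m.-tuple A),
    [/\ (0 < m)%N, forall i : 'I_m, X`_i = x ^+ i * v, free X
      & x ^+ m * v \in <<X>>%VS].
Proof.
move=> v0; pose X m := mktuple (fun i : 'I_m => x ^+ i * v).
have XE m i : (i < m)%N -> (X m)`_i = x ^+ i * v.
  by move=> im; rewrite -[i]/(val (Ordinal im)) -tnth_nth tnth_mktuple.
have exP : exists m, ~~ free (X m.+1).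
  exists (\dim {:A}); apply: contraT; rewrite negbK => /eqP fX.
  by have := dimvS (subvf <<X (\dim {:A}).+1>>); rewrite fX size_tuple ltnn.
case: (ex_minnP exP) => m nfX minm.
have XS k : X k.+1 = rcons (X k) (x ^+ k * v) :> seq A.
  apply: (@eq_from_nth _ 0); first by rewrite size_rcons !size_tuple.
  move=> i; rewrite size_tuple => ik; rewrite XE // nth_rcons.
  rewrite size_tuple; move: ik; rewrite ltnS leq_eqVlt => /orP[/eqP ->|ik].
    by rewrite ltnn eqxx.
  by rewrite ik XE.
have m0 : (0 < m)%N.
  rewrite lt0n; apply: contraNneq nfX => ->.
  by rewrite XS (_ : X 0 = [::] :> seq A) ?seq1_free ?expr0 ?mul1r //;
    apply: size0nil; rewrite size_tuple.
have fX : free (X m).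
  rewrite -(prednK m0); apply: contraT => /minm; rewrite leqNgt.
  by rewrite prednK ?leqnn.
exists m, (X m); split=> // [i|]; first exact: XE.
apply: contraR nfX => xX.
have pX : perm_eq (rcons (X m) (x ^+ m * v)) (x ^+ m * v :: X m).
  by rewrite perm_rcons.
by rewrite XS (perm_free pX) free_cons xX.
Qed.

(** * Finite order of grouplike elements *)

Section Grouplike.

Variables (K : fieldType) (H : hopfAlgType K).

(* Applying coord_i (x) id to the coproduct of a minimal dependency
   g ^+ m = \sum_i c_i g ^+ i gives c_i g ^+ m = c_i g ^+ i. *)
Lemma grouplike_order (g : H) : g \is a GRing.unit -> comul g = tens g g ->
  exists2 d, (0 < d)%N & g ^+ d = 1.
Proof.
move=> gu gg.
have ggX n : comul (g ^+ n) = tens (g ^+ n) (g ^+ n).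
  rewrite rmorphXn /= gg; elim: n => [|n IH]; first by [].
  by rewrite exprS IH -[LHS]/(tens_mul _ _) tens_mulE -!exprS.
have [m [X [m0 XE fX]]] := powers_dep g (oner_neq0 H).
rewrite mulr1 => /coord_span gm.
have [i ci0] : exists i, coord X i (g ^+ m) != 0.
  apply/existsP; apply: contraT; rewrite negb_exists => /forallP c0.
  have := unitrX m gu; rewrite gm big1 ?unitr0 // => i _.
  by move/negPn/eqP: (c0 i) => ->; rewrite scale0r.
pose f (h : H) := \sw_(a, b <- h) (coord X i a *: b).
have lc : linear (coord X i : H -> K^o) by exact: linearP.
have lf : linear f by rewrite /f; lin.
have fE n : f (g ^+ n) = coord X i (g ^+ n) *: g ^+ n.
  by rewrite /f /sw ggX tlift_tens //; lin.
have cE (j : 'I_m) : coord X i (g ^+ j) = (j == i)%:R.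
  by rewrite -[g ^+ j]mulr1 -XE coord_free.
have : f (g ^+ m) = coord X i (g ^+ m) *: g ^+ i.
  rewrite {1}gm (lin_sum _ _ _ lf) (bigD1 i) //= big1 ?addr0 => [|j ji].
    by rewrite (linZ _ _ lf) XE mulr1 fE cE eqxx scale1r.
  by rewrite (linZ _ _ lf) XE mulr1 fE cE (negPf ji) scale0r scaler0.
rewrite fE => /(scalerI ci0) gmi.
exists (m - i)%N; first by rewrite subn_gt0.
apply: (mulrI (unitrX i gu)).
by rewrite -exprD subnKC ?mulr1 // ltnW.
Qed.

End Grouplike.

(** * Central primitive idempotents *)

Section Blocks.

Variables (K : closedFieldType) (H : hopfAlgType K).
Hypotheses (char0 : [pchar K] =i pred0) (ssH : semisimple H).
Implicit Types (e f x y z : H).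

Definition central z : Prop := forall x, z * x = x * z.

Lemma centralM y z : central y -> central z -> central (y * z).
Proof. by move=> yC zC x; rewrite -mulrA zC mulrA yC mulrA. Qed.

Lemma centralB y z : central y -> central z -> central (y - z).
Proof. by move=> yC zC x; rewrite mulrBl mulrBr yC zC. Qed.

Lemma central_scalar (c : K) : central c%:A.
Proof. by move=> x; rewrite -scalerAl -scalerAr mul1r mulr1. Qed.

(** The component [f] of [1] in the two-sided ideal [H y], along a complementary left ideal, is a
    right identity there; centrality of [y] makes it a left identity as well, hence central. *)
Lemma central_ideal_idem y : central y ->
  exists f a, [/\ central f, f * f = f, f = a * y & f * y = y].
Proof.
move=> yC; pose I := limg (amulr y).
have IP x : reflect (exists a, x = a * y) (x \in I).
  apply: (iffP memv_imgP) => [[a _ ->]|[a ->]]; exists a; rewrite ?memvf ?lfunE //.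
have lI : left_ideal I.
  by move=> b x /IP[a ->]; apply/IP; exists (b * a); rewrite mulrA.
have rI b x : x \in I -> x * b \in I.
  by move=> /IP[a ->]; apply/IP; exists (a * b); rewrite -!mulrA yC.
have [J [lJ IJ1 IJ0]] := ssH lI.
have /memv_addP[f fI [f' f'J def1]] : 1 \in (I + J)%VS by rewrite IJ1 memvf.
have xf x : x \in I -> x * f = x.
  move=> xI; apply/eqP; rewrite -subr_eq0 -memv0 -IJ0 memv_cap rpredB ?lI //=.
  rewrite -opprB rpredN -[X in X - _]mulr1 -mulrBr def1 addrC addKr.
  exact: lJ.
have ff : f * f = f by rewrite xf.
have /IP[a fa] := fI.
have fx x : x \in I -> f * x = x.
  move=> /IP[b ->]; rewrite -yC mulrA {1}fa -[a * y]yC.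
  have yf : y * f = y by rewrite xf //; apply/IP; exists 1; rewrite mul1r.
  by rewrite yC -fa -yC yf.
exists f, a; split=> //.
  by move=> x; rewrite -[LHS]xf ?rI // -mulrA [RHS](esym (fx _ _)) ?mulrA // lI.
by apply: fx; apply/IP; exists 1; rewrite mul1r.
Qed.

Definition prim_idem e : Prop :=
  [/\ e != 0, central e, e * e = e
    & forall f, central f -> f * f = f -> f * e = f -> f = 0 \/ f = e].

(** Schur's lemma by idempotents. A polynomial killing [z] on the block splits into linear factors;
    for a root [c], the ideal of [(z - c) e] has identity [0] or [e]. In the first case [z e = c e];
    in the second the factor is cancelled and the induction continues. *)
Lemma prim_idem_scalar e z : prim_idem e -> central z -> exists c : K, z * e = c *: e.
Proof.
move=> [e0 eC ee eprim] zC.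
suff root_z (rs : seq K) : horner_alg z (\prod_(c <- rs) ('X - c%:P)) * e = 0 ->
    exists c : K, z * e = c *: e.
  have [m [X [m0 XE fX /coord_span zm]]] := powers_dep z e0.
  pose q := \poly_(i < m) (if insub i is Some j then coord X j (z ^+ m * e) else 0).
  pose p := 'X^m - q.
  have pz : horner_alg z p * e = 0.
    rewrite rmorphB /= rmorphXn /= horner_algX mulrBl zm /q poly_def.
    rewrite rmorph_sum /= mulr_suml -sumrB big1 // => i _.
    rewrite valK linearZ /= rmorphXn /= horner_algX.
    by rewrite -!scalerAl mul1r XE subrr.
  have p0 : p != 0.
    apply: contraTneq isT => /polyP/(_ m).
    rewrite coef0 coefB coefXn eqxx coef_poly ltnn subr0 => /eqP.
    by rewrite oner_eq0.
  have [rs pE] := closed_field_poly_normal p.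
  apply: (root_z rs); apply: (scalerI (_ : lead_coef p != 0)).
    by rewrite lead_coef_eq0.
  by rewrite scaler0 -pz [in RHS]pE -mul_polyC rmorphM /= horner_algC -!scalerAl mul1r.
elim: rs => [|c rs IH]; first by rewrite big_nil rmorph1 mul1r => /eqP; rewrite (negPf e0).
rewrite big_cons; set Q := \prod_(_ <- _) _; rewrite -/Q in IH => zQ.
pose zc := z - c%:A; pose y := zc * e.
have zcE : horner_alg z ('X - c%:P) = zc.
  by rewrite rmorphB /= horner_algX horner_algC.
have yC : central y by apply: centralM => //; apply: centralB => //; exact: central_scalar.
have [f [a [fC ff fa fy]]] := central_ideal_idem yC.
have fe : f * e = f by rewrite fa /y -!mulrA ee.
case: (eprim f fC ff fe) => [f0|fE].
  exists c; apply/eqP; rewrite -subr_eq0.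
  have := fy; rewrite f0 mul0r => /esym/eqP.
  by rewrite /y /zc mulrBl -scalerAl mul1r.
apply: IH; rewrite -fE fa -yC mulrA /y mulrA -zcE -rmorphM mulrC zQ.
by rewrite mul0r.
Qed.

Lemma natr_inj_char0 m n : (m%:R = n%:R :> K) -> m = n.
Proof.
wlog mn : m n / (m <= n)%N.
  move=> W E; have [mn|/ltnW nm] := leqP m n; first exact: W.
  by rewrite (W _ _ nm (esym E)).
move=> E; apply/eqP; rewrite eqn_leq mn -subn_eq0 -(natr_eq0_char0 char0).
by rewrite natrB // E subrr eqxx.
Qed.

(** Induction on the rank of [e]: a proper central idempotent [f] below [e] splits it as
    [f + (e - f)], and the ranks, being traces, add up. *)
Lemma prim_idem_decomp : exists es : seq H,
  (forall e, e \in es -> prim_idem e) /\ \sum_(e <- es) e = 1.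
Proof.
pose rk e : nat := \rank (lmx (fun x : H => e * x)).
have rkE e : e * e = e -> trl e = (rk e)%:R by exact: trl_idem.
suff decomp n e : central e -> e * e = e -> (rk e <= n)%N ->
    exists es : seq H,
      (forall f, f \in es -> prim_idem f) /\ \sum_(f <- es) f = e.
  by apply: (decomp (rk 1)) => //; [move=> x|]; rewrite !mul1r ?mulr1.
elim: n e => [|n IH] e eC ee.
  rewrite leqn0 => /eqP r0; exists [::]; split=> //.
  by rewrite big_nil; apply/esym/(trl_idem_eq0 char0 ee); rewrite rkE // r0.
move=> ren; have [->|e0] := eqVneq e 0.
  by exists [::]; rewrite big_nil.
case: (classic (prim_idem e)) => [pe|npe].
  exists [:: e]; rewrite big_seq1; split=> // f.
  by rewrite inE => /eqP ->.
have [f [fC ff fe f0 fne]] :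
    exists f, [/\ central f, f * f = f, f * e = f, f != 0 & f != e].
  apply: NNPP => nf; apply: npe; split=> // f fC ff fe.
  have [->|f0] := eqVneq f 0; first by left.
  have [->|fne] := eqVneq f e; first by right.
  by case: nf; exists f.
have gg : (e - f) * (e - f) = e - f.
  by rewrite mulrBl !mulrBr ee ff fe -fC fe subrr subr0.
have gC : central (e - f) by exact: centralB.
have rk0 x : x * x = x -> x != 0 -> (0 < rk x)%N.
  move=> xx x0; rewrite lt0n; apply: contraNneq x0 => r0.
  by apply/eqP/(trl_idem_eq0 char0 xx); rewrite rkE // r0.
have rkD : rk e = (rk f + rk (e - f)%R)%N.
  apply: natr_inj_char0; rewrite natrD -!rkE //.
  by rewrite -(linD _ _ (@lin_trl K H)) addrC subrK.
have rf := rk0 f ff f0.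
have rg : (0 < rk (e - f)%R)%N by apply: rk0; rewrite // subr_eq0 eq_sym.
have [|fs [pfs fsE]] := IH f fC ff.
  by rewrite -ltnS (leq_trans _ ren) // rkD -[X in (X < _)%N]addn0 ltn_add2l.
have [|gs [pgs gsE]] := IH (e - f) gC gg.
  by rewrite -ltnS (leq_trans _ ren) // rkD -[X in (X < _)%N]add0n ltn_add2r.
exists (fs ++ gs); split=> [x|].
  by rewrite mem_cat => /orP[/pfs|/pgs].
by rewrite big_cat /= fsE gsE addrC subrK.
Qed.

End Blocks.

(** * Sums of roots of unity *)

Section RootsOfUnity.

Variable K : closedFieldType.
Hypothesis char0 : [pchar K] =i pred0.

Lemma intr_eq0_char0 (c : int) : (c%:~R == 0 :> K) = (c == 0).
Proof.
have n0 := (pcharf0P K).1 char0.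
by case: c => n; rewrite ?NegzE ?mulrNz ?oppr_eq0 n0.
Qed.

Lemma prim_root_exists_char0 M : (0 < M)%N -> exists z : K, M.-primitive_root z.
Proof.
pose p : {poly K} := 'X^M - 1; have [r Dp] := closed_field_poly_normal p.
move=> M0; rewrite (monicP _) ?monicXnsubC // scale1r in Dp.
have rn1: all M.-unity_root r by apply/allP=> z; rewrite -root_prod_XsubC -Dp.
have sz_r: (M < (size r).+1)%N.
  by rewrite -(size_prod_XsubC r id) -Dp size_XnsubC.
have [|z] := hasP (has_prim_root M0 rn1 _ sz_r); last by exists z.
rewrite -separable_prod_XsubC -Dp separable_Xn_sub_1 //.
by rewrite ((pcharf0P K).1 char0) -lt0n.
Qed.

(** [A] is killed by [X^(M+1) - X], which has distinct roots, so it is diagonalizable with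
    eigenvalues zero or powers of [z]. The list [s] omits the zero eigenvalues, which contribute
    nothing once [0 < k]. *)
Lemma mxtrace_unityS n (A : 'M[K]_n.+1) M (z : K) : M.-primitive_root z ->
  A ^+ M.+1 = A ->
  exists s : seq nat, forall k, (0 < k)%N -> \tr (A ^+ k) = \sum_(a <- s) z ^+ (a * k).
Proof.
move=> zM AM; have M0 := prim_order_gt0 zM.
pose rs := 0 :: [seq z ^+ i | i <- iota 0 M].
have rsE : \prod_(x <- rs) ('X - x%:P) = 'X^(M.+1) - 'X :> {poly K}.
  rewrite big_cons subr0 big_map -{1}[M]subn0 (factor_Xn_sub_1 zM).
  by rewrite mulrBr mulr1 -exprS.
have /diagonalizableP [P Pu /(diagonalizable_forLR Pu)[d]] : exists2 rs, uniq rs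
    & mxminpoly A %| \prod_(x <- rs) ('X - x%:P).
  exists rs.
    rewrite /= map_inj_in_uniq ?iota_uniq ?andbT => [|i j].
      apply/mapP => -[i _ /esym/eqP]; apply/negP.
      by rewrite expf_neq0 // (prim_root_eq0 zM) -lt0n.
    rewrite !mem_iota /= !add0n => iM jM /eqP.
    by rewrite (eq_prim_root_expr zM) !modn_small // => /eqP.
  rewrite rsE; apply: mxminpoly_min.
  by rewrite rmorphB rmorphXn /= horner_mx_X AM subrr.
rewrite mxpoly.conjVmx // => AE.
have AX k : A ^+ k = invmx P *m diag_mx (map_mx (fun x => x ^+ k) d) *m P.
  elim: k => [|k IH].
    rewrite (_ : map_mx _ d = const_mx 1) ?diag_const_mx ?mulmx1 ?mulVmx //.
    by apply/matrixP => i j; rewrite !mxE.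
  rewrite exprS IH {1}AE -[_ * _]/(_ *m _) !mulmxA mulmxK //; congr (_ *m _).
  rewrite -!mulmxA mulmx_diag; congr (_ *m _); congr diag_mx.
  by apply/rowP => j; rewrite !mxE exprS.
have trA k : \tr (A ^+ k) = \sum_i d 0 i ^+ k.
  rewrite AX mxtrace_mulC mulmxA mulmxV // mul1mx mxtrace_diag.
  by apply: eq_bigr => i _; rewrite mxE.
have dM i : d 0 i ^+ M.+1 = d 0 i.
  have /matrixP/(_ i i) : diag_mx (map_mx (fun x => x ^+ M.+1) d) = diag_mx d.
    apply: (can_inj (mulKmx (_ : invmx P \in unitmx))); rewrite ?unitmx_inv //.
    by apply: (can_inj (mulmxK Pu)); rewrite -AX -AE.
  by rewrite !mxE eqxx.
pose s := [seq d 0 i | i <- enum 'I_n.+1 & d 0 i != 0].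
have zlog x : x \in s -> exists a : nat, x = z ^+ a.
  case/mapP=> i; rewrite mem_filter => /andP[di0 _] ->.
  have : d 0 i ^+ M = 1 by apply: (mulfI di0); rewrite -exprS dM mulr1.
  by case/(prim_rootP zM) => j ->; exists j.
have [l lE] : exists l : seq nat, s = [seq z ^+ a | a <- l].
  elim: {AX trA dM} s zlog => [|x s IH] zlog; first by exists [::].
  have [a ->] := zlog x (mem_head _ _).
  have [|l ->] := IH; last by exists (a :: l).
  by move=> y ys; apply: zlog; rewrite inE ys orbT.
exists l => k k0; rewrite trA.
transitivity (\sum_(x <- s) x ^+ k).
  rewrite big_map big_filter big_enum_cond /= [RHS]big_mkcond /=.
  apply: eq_bigr => i _; case: eqP => // ->.
  by rewrite expr0n -[k]prednK.
by rewrite lE big_map; apply: eq_bigr => a _; rewrite exprM.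
Qed.

Lemma mxtrace_unity n (A : 'M[K]_n) M (z : K) : M.-primitive_root z ->
  A ^+ M.+1 = A ->
  exists s : seq nat, forall k, (0 < k)%N -> \tr (A ^+ k) = \sum_(a <- s) z ^+ (a * k).
Proof.
case: n A => [|n] A zM AM; last exact: mxtrace_unityS zM AM.
by exists [::] => k _; rewrite big_nil /mxtrace big_ord0.
Qed.

End RootsOfUnity.

(** * Transfer of integer relations between roots of unity from [K] to [algC] *)

Section CyclotomicTransfer.

Variable K : closedFieldType.
Hypothesis char0 : [pchar K] =i pred0.
Variables (M : nat) (z : K) (x : algC).
Hypotheses (zM : M.-primitive_root z) (xM : M.-primitive_root x).

Lemma root_Cyclotomic : root (map_poly intr 'Phi_M) z.
Proof.
have M0 := prim_order_gt0 zM.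
have XE n : map_poly intr ('X^n - 1 : {poly int}) = 'X^n - 1 :> {poly K}.
  by rewrite rmorphB rmorph1 /= map_polyXn.
have : root (map_poly intr ('X^M - 1 : {poly int})) z.
  by rewrite XE /root !hornerE /= prim_expr_order // subrr.
rewrite -prod_Cyclotomic // rmorph_prod /root horner_prod prodf_seq_eq0.
case/hasP => d; rewrite -dvdn_divisors // => dM /= dz.
suff dE : d = M by rewrite -dE.
have d0 : (0 < d)%N := dvdn_gt0 M0 dM.
apply/eqP; rewrite eqn_dvd dM (prim_order_dvd zM) -subr_eq0.
have : root (map_poly intr ('X^d - 1 : {poly int})) z.
  rewrite -prod_Cyclotomic // rmorph_prod /root horner_prod prodf_seq_eq0.
  by apply/hasP; exists d; rewrite // -dvdn_divisors.
by rewrite XE /root !hornerE.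
Qed.

(* Both conditions amount to divisibility of F by the cyclotomic polynomial. *)
Lemma root_int_transfer (F : {poly int}) :
  root (map_poly intr F) z = root (map_poly intr F) x.
Proof.
have [p [pE p_mon pdv]] := minCpolyP x.
have ZQC (G : {poly int}) : map_poly ratr (map_poly intr G) = map_poly intr G :> {poly algC}.
  by rewrite -map_poly_comp; apply: eq_map_poly => c; rewrite /= rmorph_int.
have pPhi : p = map_poly intr 'Phi_M.
  apply: (map_inj_poly (fmorph_inj (ratr : rat -> algC)) (rmorph0 _)).
  by rewrite -pE ZQC (Cintr_Cyclotomic xM) (minCpoly_cyclotomic xM).
have Phiz := root_Cyclotomic.
rewrite -ZQC pdv; apply/idP/idP => [Fz|/dvdpP[g FE]].
  (* If the minimal polynomial [p] of [x] does not divide [F], minimality makes the two coprime; a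
     Bezout relation with cleared denominators, evaluated at [z], says that a nonzero integer is
     zero. *)
  apply: contraT => pF.
  have : coprimep p (map_poly intr F).
    have /dvdpP[h hE] := dvdp_gcdl p (map_poly intr F).
    set g := gcdp _ _ in hE *.
    have : root (map_poly ratr (h * g)) x by rewrite -hE pdv dvdpp.
    rewrite rmorphM rootM !pdv => /orP[ph|pg]; last first.
      by case/negP: pF; apply: dvdp_trans pg (dvdp_gcdr _ _).
    have h0 : h != 0.
      by apply: contraTneq (monic_neq0 p_mon) => h0; rewrite hE h0 mul0r eqxx.
    have g0 : g != 0.
      by apply: contraTneq (monic_neq0 p_mon) => g0; rewrite hE g0 mulr0 eqxx.
    have le : ((size h + size g).-1 <= size h)%N.
      by rewrite -size_mul // -hE dvdp_leq.
    rewrite -[coprimep _ _]/(size g == 1)%N eqn_leq size_poly_gt0 g0 andbT.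
    move: le; have [s0 s1] : (0 < size h)%N /\ (0 < size g)%N.
      by rewrite !size_poly_gt0.
    by rewrite -(prednK s1) addnS /= -[X in (_ <= X)%N]addn0 leq_add2l.
  case/Bezout_eq1_coprimepP => -[u v] /= uvE.
  have [u' [a a0 uE]] := rat_poly_scale u.
  have [v' [c c0 vE]] := rat_poly_scale v.
  have : c *: u' * 'Phi_M + a *: v' * F = (a * c)%:P.
    apply: (map_inj_poly (intr_inj : injective (intr : int -> rat)) (rmorph0 _)).
    rewrite rmorphD !rmorphM /= !map_polyZ map_polyC /= -pPhi.
    have a0' : a%:~R != 0 :> rat by rewrite intr_eq0.
    have c0' : c%:~R != 0 :> rat by rewrite intr_eq0.
    rewrite -[_ u'](scalerKV a0') -uE -[_ v'](scalerKV c0') -vE.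
    rewrite !scalerA [c%:~R * _]mulrC -!scalerAl -scalerDr uvE.
    by rewrite alg_polyC map_polyC -polyCM.
  move/(congr1 (fun G : {poly int} => (map_poly intr G).[z])).
  rewrite rmorphD !rmorphM /= !hornerE (eqP Phiz) (eqP Fz) !mulr0 addr0.
  rewrite map_polyC hornerC /= => /esym/eqP.
  by rewrite map_polyC hornerC mulf_eq0 !intr_eq0_char0 // (negPf a0) (negPf c0).
have [g' [a a0 gE]] := rat_poly_scale g.
have : a *: F = g' * 'Phi_M.
  apply: (map_inj_poly (intr_inj : injective (intr : int -> rat)) (rmorph0 _)).
  have a0' : a%:~R != 0 :> rat by rewrite intr_eq0.
  by rewrite map_polyZ rmorphM /= -pPhi FE gE -scalerAl scalerKV.
move/(congr1 (fun G : {poly int} => (map_poly intr G).[z])).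
rewrite rmorphM /= map_polyZ !hornerE (eqP Phiz) mulr0 => /eqP.
by rewrite mulf_eq0 intr_eq0_char0 // (negPf a0).
Qed.

(* In algC the second sum is the conjugate of the first. *)
Lemma unity_sum_neq0 (ps : seq (nat * seq nat)) : ps != [::] ->
    (forall p, p \in ps -> (0 < p.1)%N /\ \sum_(a <- p.2) z ^+ a != 0) ->
  \sum_(p <- ps) (p.1%:R * ((\sum_(a <- p.2) z ^+ a) *
                            (\sum_(a <- p.2) z ^+ (a * M.-1)))) != 0.
Proof.
move=> ps0 psP.
have M0 := prim_order_gt0 zM.
pose P (s : seq nat) : {poly int} := \sum_(a <- s) 'X^a.
pose P' (s : seq nat) : {poly int} := \sum_(a <- s) 'X^(a * M.-1).
pose F : {poly int} := \sum_(p <- ps) (p.1%:R * (P p.2 * P' p.2)).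
have PE (R : comNzRingType) (y : R) s : (map_poly intr (P s)).[y] = \sum_(a <- s) y ^+ a.
  rewrite rmorph_sum horner_sum; apply: eq_bigr => a _.
  by rewrite /= map_polyXn hornerXn.
have PE' (R : comNzRingType) (y : R) s :
    (map_poly intr (P' s)).[y] = \sum_(a <- s) y ^+ (a * M.-1).
  rewrite rmorph_sum horner_sum; apply: eq_bigr => a _.
  by rewrite /= map_polyXn hornerXn.
have FE (R : comNzRingType) (y : R) : (map_poly intr F).[y] =
    \sum_(p <- ps) (p.1%:R * ((\sum_(a <- p.2) y ^+ a) *
                              (\sum_(a <- p.2) y ^+ (a * M.-1)))).
  rewrite rmorph_sum horner_sum; apply: eq_bigr => p _.
  rewrite !rmorphM rmorph_nat /= !hornerM PE PE'; congr (_ * _).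
  by rewrite -[p.1%:R]polyC_natr hornerC.
rewrite -FE; apply: contraNN ps0.
rewrite -/(root _ z) root_int_transfer /root FE.
have xconj : x^* = x ^+ M.-1.
  have nx : `|x| = 1.
    by apply/eqP; rewrite -(@pexpr_eq1 _ _ M) // -normrX prim_expr_order // normr1.
  have x0 : x != 0 by rewrite -normr_eq0 nx oner_eq0.
  apply: (mulfI x0); rewrite -normCK nx expr1n -exprS prednK //.
  by rewrite prim_expr_order.
have sE (s : seq nat) : (\sum_(a <- s) x ^+ a) * (\sum_(a <- s) x ^+ (a * M.-1)) =
    `|\sum_(a <- s) x ^+ a| ^+ 2.
  rewrite normCK rmorph_sum; congr (_ * _); apply: eq_bigr => a _.
  by rewrite rmorphXn /= xconj -exprM mulnC.
under eq_bigr => p _ do rewrite sE.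
rewrite psumr_eq0 => [/allP psx|p _]; last by rewrite mulr_ge0 ?ler0n ?exprn_ge0.
case: ps {F FE} psP psx => // p ps psP psx.
have [p0] := psP p (mem_head _ _); have := psx p (mem_head _ _).
rewrite /= mulf_eq0 pnatr_eq0 -leqn0 leqNgt p0 /= sqrf_eq0 normr_eq0.
by rewrite -!PE -/(root _ x) -/(root _ z) root_int_transfer => ->.
Qed.

End CyclotomicTransfer.

(** * Nonvanishing of the trace of the square of the antipode *)

Section Cosemisimple.

Variables (K : closedFieldType) (H : hopfAlgType K).
Hypotheses (char0 : [pchar K] =i pred0) (ssH : semisimple H).
Variable L : H.
Hypotheses (intL : integral L) (epsL : counit L = 1).
Local Notation S := (@antipode K H).
Local Notation lam := (@lam K H).
Local Notation w := (drinfeld L).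
Local Notation g := (modular L).

Lemma lmx_mulX (u : H) k : lmx (fun x : H => u ^+ k * x) = lmx (fun x : H => u * x) ^+ k.
Proof.
elim: k => [|k IH].
  by rewrite expr0 -[RHS]lmx_id; apply: eq_lmx => x; rewrite mul1r.
rewrite [RHS]exprS -[RHS]/(_ *m _) -IH lmxM; last by lin.
by apply: eq_lmx => x; rewrite exprSr mulrA.
Qed.

Lemma antipode2_order : exists2 d, (1 < d)%N & forall h, iter d (fun x => S (S x)) h = h.
Proof.
have gu : g \is a GRing.unit.
  by apply/unitrP; exists (S g); rewrite antipode_modularl // antipode_modularr.
have Sg : S g = g^-1 by rewrite -[LHS]mulr1 -(mulrV gu) mulrA antipode_modularl // mul1r.
have [d d0 gd] := grouplike_order gu (comul_modular intL epsL).
(* Conjugation by [g] is two applications of [S^2], hence the doubling, which also makes the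
   exponent exceed 1, so that [M.-1] is positive later. *)
exists (d.*2); first by rewrite -[d]prednK // doubleS.
suff E n h : iter n.*2 (fun x => S (S x)) h = g ^- n * h * g ^+ n.
  by move=> h; rewrite E gd invr1 mul1r mulr1.
elim: n h => [|n IH] h; first by rewrite /= expr0 invr1 mul1r mulr1.
rewrite doubleS !iterS IH (antipode4 intL epsL) Sg -!exprVn.
by rewrite exprS exprSr !mulrA.
Qed.

Lemma drinfeld_exp n h : w ^+ n * h = iter n (fun x => S (S x)) h * w ^+ n.
Proof.
elim: n h => [|n IH] h; first by rewrite expr0 mul1r mulr1.
by rewrite exprS -mulrA IH mulrA (drinfeld_comm intL) -mulrA -exprS.
Qed.

Lemma closed_root M (c : K) : (0 < M)%N -> exists t : K, t ^+ M = c.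
Proof.
move=> M0; have [t tE] := solve_monicpoly (fun i => if i == 0%N then c else 0) M0.
exists t; rewrite tE; case: M M0 {tE} => // M _.
by rewrite big_ord_recl big1 ?expr0 ?mulr1 ?addr0 // => i _; rewrite mul0r.
Qed.

(* w ^+ M * e is a scalar multiple of e, so a multiple u of w * e satisfies
   u ^+ M = e; the scale is determined by trl (w * e) = trl e.  The factorial
   clears the denominator trl e. *)
Lemma block_trace M (z : K) e : (1 < M)%N -> M.-primitive_root z ->
    (forall h, iter M (fun x => S (S x)) h = h) -> prim_idem e ->
  exists (q : nat) (s : seq nat), [/\ (0 < q)%N, \sum_(a <- s) z ^+ a != 0 &
    ((\dim {:H})`!)%:R * (trl (w^-1 * e) : K) =
    q%:R * ((\sum_(a <- s) z ^+ a) * (\sum_(a <- s) z ^+ (a * M.-1)))].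
Proof.
move=> M1 zM SM pe; have [e0 eC ee _] := pe.
have M0 : (0 < M)%N by exact: ltnW.
have wu := drinfeld_unit intL epsL char0 ssH.
have ltrl := @lin_trl K H.
have wMC : central (w ^+ M) by move=> h; rewrite drinfeld_exp SM.
have [mu muE] := prim_idem_scalar ssH pe wMC.
have mu0 : mu != 0.
  apply: contraNneq e0 => mu0; apply/eqP/(mulrI (unitrX M wu)).
  by rewrite muE mu0 scale0r mulr0.
have [th thE] := closed_root mu M0.
have th0 : th != 0.
  by apply: contraNneq mu0 => th0; rewrite -thE th0 expr0n -[M]prednK.
pose u := th^-1 *: (w * e).
have ueu : u * e = u by rewrite /u -scalerAl -mulrA ee.
have uX k : u ^+ k.+1 = th ^- k.+1 *: (w ^+ k.+1 * e).
  rewrite exprZn exprVn; congr (_ *: _).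
  elim: k => [|k IH]; first by rewrite !expr1.
  by rewrite exprS IH -mulrA [e * _]mulrA eC -!mulrA ee mulrA -exprS.
have uM : u ^+ M = e.
  rewrite -(prednK M0) uX (prednK M0) muE thE scalerA mulVf // scale1r //.
have uM1 : u ^+ M.+1 = u by rewrite exprS uM.
have [s sE] : exists s : seq nat, forall k, (0 < k)%N ->
    (trl (u ^+ k) : K) = \sum_(a <- s) z ^+ (a * k).
  have [|s sE] := mxtrace_unity (A := lmx (fun x : H => u * x)) zM.
    by rewrite -lmx_mulX uM1.
  by exists s => k k0; rewrite -sE // -lmx_mulX -ltr_mx.
pose d := \rank (lmx (fun x : H => e * x)).
have dE : trl e = d%:R by exact: trl_idem.
have d0 : (0 < d)%N.
  rewrite lt0n; apply: contraNneq e0 => d0.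
  by apply/eqP/(trl_idem_eq0 char0 ee); rewrite dE d0.
have wE : w * e = th *: u by rewrite /u scalerA mulfV // scale1r.
have dth : d%:R = th * \sum_(a <- s) z ^+ a.
  rewrite -dE -(trl_drinfeld_central epsL eC) wE (linZ _ _ ltrl) -[u]expr1 sE //.
  by congr (_ * _); apply: eq_bigr => a _; rewrite muln1.
(* On the block [u ^+ M.-1] inverts [u]; this is the source of the exponents [a * M.-1] of inverse
   roots of unity. *)
have wV : w^-1 * e = th^-1 *: u ^+ M.-1.
  apply: (mulrI wu); rewrite mulVKr // -scalerAr.
  have -> : u ^+ M.-1 = e * u ^+ M.-1.
    have M2 : (0 < M.-1)%N by rewrite -ltnS prednK.
    by rewrite -(prednK M2) exprSr eC -mulrA ueu.
  by rewrite mulrA wE -scalerAl -exprS prednK // uM scalerA mulVf // scale1r.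
have dvd : (d %| (\dim {:H})`!)%N by rewrite dvdn_fact // d0 rank_leq_row.
exists ((\dim {:H})`! %/ d)%N, s; split.
- by rewrite divn_gt0 // dvdn_leq // fact_gt0.
- apply: contraTneq d0 => s0; rewrite -leqNgt leqn0 -(natr_eq0_char0 char0).
  by rewrite dth s0 mulr0.
have -> : (\dim {:H})`!%:R = ((\dim {:H})`! %/ d)%:R * d%:R :> K.
  by rewrite -natrM divnK.
rewrite -mulrA; congr (_ * _); rewrite dth wV (linZ _ _ ltrl).
rewrite sE; last by rewrite -ltnS prednK.
by rewrite -[th^-1 *: _]/(th^-1 * _) mulrACA divff // mul1r.
Qed.

(** [lam 1 = lam (w^-1 * w) = trl w^-1]. Split along the blocks and scaled by a factorial, this is a
    sum as in [unity_sum_neq0], nonempty because [1] is nonzero. *)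
Lemma lam1_neq0 : lam 1 != 0.
Proof.
have [M M1 SM] := antipode2_order.
have [z zM] := prim_root_exists_char0 char0 (ltnW M1).
have [x xM] := C_prim_root_exists (ltnW M1).
have wu := drinfeld_unit intL epsL char0 ssH.
have ltrl := @lin_trl K H.
have [es [pes esE]] := prim_idem_decomp H char0.
have [ps [szps psP psE]] : exists ps : seq (nat * seq nat), [/\ size ps = size es,
    forall p, p \in ps -> (0 < p.1)%N /\ \sum_(a <- p.2) z ^+ a != 0 &
    \sum_(e <- es) ((\dim {:H})`!)%:R * (trl (w^-1 * e) : K) =
    \sum_(p <- ps) (p.1%:R * ((\sum_(a <- p.2) z ^+ a) *
                            (\sum_(a <- p.2) z ^+ (a * M.-1))))].
  elim: es pes {esE} => [|e es IH] pes; first by exists [::]; rewrite !big_nil.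
  have [|ps [szps psP psE]] := IH.
    by move=> f fes; apply: pes; rewrite inE fes orbT.
  have [q [s [q0 s0 qsE]]] := block_trace M1 zM SM (pes e (mem_head _ _)).
  exists ((q, s) :: ps); split; first by rewrite /= szps.
    by move=> p; rewrite inE => /orP[/eqP ->|/psP].
  by rewrite !big_cons psE qsE.
have ps0 : ps != [::].
  rewrite -size_eq0 szps size_eq0; apply: contra_eqN esE => /eqP ->.
  by rewrite big_nil eq_sym oner_neq0.
have := unity_sum_neq0 char0 zM xM ps0 psP; rewrite -psE.
apply: contraNneq => l0; rewrite -mulr_sumr.
have -> : \sum_(e <- es) (trl (w^-1 * e) : K) = trl w^-1.
  by rewrite -[w^-1 in RHS]mulr1 -esE mulr_sumr (lin_sum _ _ _ ltrl).
by rewrite (trl_lam intL epsL) mulVr // l0 mulr0.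
Qed.

End Cosemisimple.

(** * The antipode is an involution *)

(** [p] and [q] are the projections onto the eigenspaces for 1 and -1. The hypothesis [f^3 = f]
    admits both an involution and its product with a commuting projection. *)
Lemma ltr_tripotent (K : fieldType) (V : vectType K) (f : V -> V) :
    2%:R != 0 :> K -> linear f -> (forall x, f (f (f x)) = f x) ->
  let p x := 2%:R^-1 *: (f (f x) + f x) in
  let q x := 2%:R^-1 *: (f (f x) - f x) in
  [/\ linear p, linear q, ltr p = (\rank (lmx p))%:R,
      ltr q = (\rank (lmx q))%:R & ltr f = ltr p - ltr q].
Proof.
move=> n2 lf fff p q.
have lp : linear p by rewrite /p; lin.
have lq : linear q by rewrite /q; lin.
split=> //.
- apply: ltr_idem => // x; rewrite /p !(linZ _ _ lf) !(linD _ _ lf) !fff.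
  rewrite -!scalerDr scalerA [f x + _]addrC -mulr2n -scaler_nat scalerA.
  by rewrite -mulrA mulVf // mulr1.
- apply: ltr_idem => // x; rewrite /q !(linZ _ _ lf) !(linB _ _ lf) !fff.
  rewrite -!scalerBr scalerA -[f x - f (f x)]opprB opprK -mulr2n -scaler_nat scalerA.
  by rewrite -mulrA mulVf // mulr1.
rewrite -[- ltr q]mulN1r -ltrZ -ltrD; apply: eq_ltr => x.
rewrite /p /q scaleN1r -scalerBr opprB addrC addrA subrK -mulr2n -scaler_nat.
by rewrite scalerA mulVf // scale1r.
Qed.

(** The difference [a - b] is a nonzero multiple of [n] of absolute value at most [a + b = n], hence
    [n] or [-n]. *)
Lemma sum_extreme_of_diff_dvd (a b c d n : nat) : (a + b = n)%N ->
  (a + n * d = b + n * c)%N -> a <> b -> a = 0%N \/ b = 0%N.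
Proof.
move=> abn E ab; have [cd|dc|cd] := ltngtP c d.
- by left; move: E; rewrite -(subnKC cd) mulnDr mulnS; lia.
- by right; move: E; rewrite -(subnKC dc) mulnDr mulnS; lia.
by case: ab; move: E; rewrite cd; lia.
Qed.

Section Involution.

Variables (K : closedFieldType) (H : hopfAlgType K).
Hypotheses (char0 : [pchar K] =i pred0) (ssH : semisimple H).
Variable L : H.
Hypotheses (intL : integral L) (epsL : counit L = 1).
Local Notation S := (@antipode K H).
Local Notation lam := (@lam K H).

Let llam : linear lam := @lin_lam K H.
Let lS : linear S := @linS K H.
Let ltrr : linear (@trr K H) := @lin_trr K H.

(** The sum of [lam(x_1) lam(S(x_2))] equals [lam(S x) lam(1)] because [lam \o S] is a left
    integral, and [lam(x) lam(1)] because [lam] is a right one; [lam 1] cancels. *)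
Lemma lam_antipode x : lam (S x) = lam x.
Proof.
have l1 := lam1_neq0 char0 ssH intL epsL.
have left := left_int_antipode intL epsL llam (@lam_right K H) x.
have right := @lam_right K H x.
apply: (mulIf l1).
transitivity (\sw_(a, b <- x) ((lam a : K) *: lam (S b)) : K^o).
  rewrite -[LHS]/((lam (S x) : K) *: lam 1) -(linZ _ _ llam) -left lin_sw //.
  by apply: (@eq_sw _ _ K^o) => a b; rewrite (linZ _ _ llam); apply: mulrC.
have llS : linear (fun x => lam (S x)) by lin.
rewrite -[RHS]/((lam x : K) *: lam 1) -[X in _ *: lam X](antipode1 H).
rewrite -(linZ _ _ llS) -right (@lin_sw _ _ _ _ (fun x => lam (S x))) //.
by apply: (@eq_sw _ _ K^o) => a b; rewrite (linZ _ _ llS).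
Qed.

Lemma antipode4_id x : S (S (S (S x))) = x.
Proof.
have m1 : modular L = 1.
  transitivity (\sw_(a, b <- L) ((lam a : K) *: b)).
    by apply: eq_sw => a b; rewrite lam_antipode.
  by rewrite lam_right lam_integral // scale1r.
by rewrite (antipode4 intL epsL) m1 antipode1 mul1r mulr1.
Qed.

Lemma trr_lam h : trr h = \sw_(a, b <- L) lam (S b * h * a).
Proof. by rewrite /trr (ltr_dual_bases intL epsL) //; lin. Qed.

(** The regular character absorbs every trace form under convolution. Once [trr] is written by dual
    bases and a product [q' S(s)] of legs of [L] is inserted under [phi], the coproduct of
    [S(t) h v] appears and [lam_right] applies. *)
Lemma trr_conv (phi : H -> K^o) h : linear phi ->
    (forall x y, phi (x * y) = phi (y * x)) ->
  \sw_(a, b <- h) ((trr a : K) *: phi b) = (trr h : K) *: phi 1.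
Proof.
move=> lphi phiC.
pose F (h1 h2 q q' s s' : H) : K^o := (lam (S s' * h1 * q) : K) *: phi (S s * h2 * q').
transitivity (\sw_(a, b <- h) \sw_(q, r <- L) \sw_(u, s' <- r) \sw_(q', s <- u)
                F a b q q' s s').
  apply: (@eq_sw _ _ K^o) => a b; rewrite trr_lam.
  rewrite (@lin_sw _ _ _ _ (fun c : K^o => (c : K) *: phi b)); last by lin.
  apply: (@eq_sw _ _ K^o) => q r.
  rewrite -[LHS](@sw_counitl _ _ _ _ (fun r => (lam (S r * a * q) : K) *: phi b)); last by lin.
  apply: (@eq_sw _ _ K^o) => u s'.
  have lb : linear (fun y => (lam (S s' * a * q) : K) *: phi (b * y) : K^o) by lin.
  have := sw_antipoder u lb; rewrite mulr1 => <-.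
  apply: (@eq_sw _ _ K^o) => q' s; rewrite /F; congr (_ *: _).
  by rewrite mulrA phiC mulrA.
have lFs' a b q q' s : linear (fun s' => F a b q q' s s') by rewrite /F; lin.
have lFs a b q q' s' : linear (fun s => F a b q q' s s') by rewrite /F; lin.
have lFq' a b q s s' : linear (fun q' => F a b q q' s s') by rewrite /F; lin.
have lFq a b q' s s' : linear (fun q => F a b q q' s s') by rewrite /F; lin.
have lF1 b q q' s s' : linear (fun a => F a b q q' s s') by rewrite /F; lin.
have lF2 a q q' s s' : linear (fun b => F a b q q' s s') by rewrite /F; lin.
transitivity (\sw_(a, b <- h) \sw_(v, t <- L) \sw_(q, q' <- v) \sw_(s, s' <- t)
                F a b q q' s s').
  apply: (@eq_sw _ _ K^o) => a b.
  rewrite (@swA _ _ K^o L (fun q q' t => \sw_(s, s' <- t) F a b q q' s s')).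
  - apply: (@eq_sw _ _ K^o) => q r.
    by rewrite (@swA _ _ K^o r (fun q' s s' => F a b q q' s s')) //.
  - by move=> *; apply: lin_swr.
  - by move=> *; apply: lin_swr.
  - by move=> *; apply: (lin_swl (f := fun x => x)).
transitivity (\sw_(v, t <- L) \sw_(p, p' <- S t * h * v) ((lam p : K) *: phi p')).
  rewrite sw_exch; apply: (@eq_sw _ _ K^o) => v t.
  rewrite sw_mul; try by lin.
  rewrite sw_mul; try by lin.
  rewrite sw_antipode; try by lin.
  rewrite [LHS](_ : _ = \sw_(s, s' <- t) \sw_(a, b <- h) \sw_(q, q' <- v) F a b q q' s s') //.
  rewrite [RHS]sw_exch; apply: (@eq_sw _ _ K^o) => a b.
  by rewrite [RHS]sw_exch.
rewrite trr_lam (@lin_sw _ _ _ _ (fun c : K^o => (c : K) *: phi 1)); last by lin.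
apply: (@eq_sw _ _ K^o) => v t.
rewrite -(linZ _ _ lphi) -lam_right lin_sw //.
by apply: (@eq_sw _ _ K^o) => a b; rewrite (linZ _ _ lphi).
Qed.

Lemma trr_antipode2 h : trr (S (S h)) = trr h.
Proof.
rewrite !trr_lam; apply: esym.
transitivity (\sw_(a, b <- S (S L)) lam (S b * S (S h) * a) : K^o).
  rewrite sw_antipode2; try by lin.
  by apply: (@eq_sw _ _ K^o) => a b; rewrite -!antipodeM lam_SS.
by rewrite !(antipode_integral intL epsL).
Qed.

Lemma trr_integral : trr L = 1.
Proof.
rewrite /trr (@ltr_rank1 _ _ _ (fun (_ : 'I_1) x => counit x : K^o) (fun=> L)).
- by rewrite big_ord1.
- by move=> _; exact: lin_counit.
- by move=> x; rewrite big_ord1 (intL _).1.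
Qed.

Local Notation N := (\dim {:H}).

(** The action of the regular character on [H]; since [trr] squares to [N trr] under convolution,
    dividing by [N] gives an idempotent. *)
Definition trproj h : H := \sw_(a, b <- h) ((trr a : K) *: b).

Lemma lin_trproj : linear trproj.
Proof. by rewrite /trproj; lin. Qed.

Lemma trr1 : trr (1 : H) = N%:R.
Proof.
rewrite -ltr_id /trr; suff : ltr (fun x : H => x * 1) = ltr (fun x : H => x) by [].
by apply: eq_ltr => x; rewrite mulr1.
Qed.

Lemma trproj_idem h : trproj (trproj h) = N%:R *: trproj h.
Proof.
rewrite {2}/trproj lin_sw; last exact: lin_trproj.
transitivity (\sw_(a, t <- h) \sw_(b, c <- t) (((trr a : K) * (trr b : K)) *: c)).
  apply: eq_sw => a t; rewrite (linZ _ _ lin_trproj).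
  rewrite (@lin_sw _ _ _ _ (fun y => (trr a : K) *: y)); last by lin.
  by apply: eq_sw => b c; rewrite scalerA.
rewrite -(@swA _ _ _ h (fun a b c => ((trr a : K) * (trr b : K)) *: c)).
- rewrite (@lin_sw _ _ _ _ (fun y => N%:R *: y)); last by lin.
  apply: eq_sw => s c; rewrite scalerA -trr1 mulrC.
  have := trr_conv s ltrr (@trrC K H) => /(congr1 (fun x : K^o => (x : K) *: c)).
  rewrite (@lin_sw _ _ _ _ (fun x : K^o => (x : K) *: c)); last by lin.
  exact.
- by move=> b c; apply: lin_scalel; apply: lin_mull.
- by move=> a c; apply: lin_scalel; apply: lin_mulr.
- by move=> a b; lin.
Qed.

Lemma trproj_antipode2 h : trproj (S (S h)) = S (S (trproj h)).
Proof.
rewrite /trproj sw_antipode2; try by lin.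
rewrite (@lin_sw _ _ _ _ (fun x => S (S x))); last by lin.
by apply: eq_sw => a b; rewrite trr_antipode2 !linearZ.
Qed.

(** Dual bases and [lamC] bring [a S(p)] together, which contracts to the counit; what remains is
    [lam 1] times [trr (S L) = trr L = 1]. *)
Lemma ltr_antipode2_trproj : ltr (fun h => S (S (trproj h))) = lam 1.
Proof.
have lP := lin_trproj.
rewrite (ltr_dual_bases intL epsL); last by lin.
transitivity (\sw_(a, t <- L) \sw_(p, q <- t)
  ((trr (S q) : K) *: lam (S (S (S p)) * a)) : K^o).
  apply: (@eq_sw _ _ K^o) => a t.
  rewrite {1}/trproj sw_antipode; try by lin.
  rewrite (@lin_sw _ _ _ _ (fun x => lam (S (S x) * a))); last by lin.
  apply: (@eq_sw _ _ K^o) => p q.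
  by rewrite (@linZ _ _ _ (fun x => lam (S (S x) * a))) //; lin.
rewrite -(@swA _ _ K^o L (fun a p q => (trr (S q) : K) *: lam (S (S (S p)) * a))); try by lin.
transitivity (\sw_(s, q <- L) (counit s *: ((trr (S q) : K) *: lam 1)) : K^o).
  apply: (@eq_sw _ _ K^o) => s q.
  have lb : linear (fun y => (trr (S q) : K) *: lam y : K^o) by lin.
  rewrite -(sw_antipoder s lb); apply: (@eq_sw _ _ K^o) => a p.
  by rewrite (lamC a).
rewrite (@sw_counitl _ _ K^o _ (fun q => (trr (S q) : K) *: lam 1)); last by lin.
by rewrite (antipode_integral intL epsL) trr_integral; apply: mul1r.
Qed.

(* trproj / N is an idempotent commuting with S^2, so that ltr S^2 = lam 1 is N
   times an integer; being nonzero, it must be N or - N. *)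
Lemma antipode2_id x : S (S x) = x.
Proof.
have n2 : 2%:R != 0 :> K by rewrite natr_eq0_char0.
have lSS : linear (fun x => S (S x)) by lin.
have lP := lin_trproj.
have Nn0 : N%:R != 0 :> K.
  rewrite natr_eq0_char0 // -lt0n lt0n dimv_eq0.
  by apply: contraTneq (memvf (1 : H)) => ->; rewrite memv0 oner_eq0.
have S3 (x0 : H) : S (S (S (S (S (S x0))))) = S (S x0) by rewrite antipode4_id.
have [lp lq rp rq tSS] := ltr_tripotent n2 lSS S3.
set p := fun x0 => _ in lp rp tSS; set q := fun x0 => _ in lq rq tSS.
(* [F] is [S^2] times a commuting projection, so its trace is an integer [c - d]; hence the ranks of
   [p] and [q] differ by [N (c - d)]. *)
pose F x0 := N%:R^-1 *: S (S (trproj x0)).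
have lF : linear F by rewrite /F; lin.
have FE x0 : F (F x0) = N%:R^-1 *: trproj x0.
  rewrite /F (linZ _ _ lP) trproj_antipode2 trproj_idem !linearZ /=.
  by rewrite antipode4_id scalerA mulVf // scale1r.
have F3 x0 : F (F (F x0)) = F x0.
  rewrite FE /F (linZ _ _ lP) trproj_antipode2 trproj_idem !linearZ /=.
  by rewrite !scalerA mulVf // mul1r.
have [_ _ rF rG tF] := ltr_tripotent n2 lF F3.
have tFE : ltr F = N%:R^-1 * lam 1 by rewrite /F ltrZ ltr_antipode2_trproj.
have lam1E : lam 1 = ltr (fun x0 : H => S (S x0)) :> K.
  by apply: eq_ltr => x0; rewrite mulr1.
have pq : ltr p + ltr q = N%:R.
  rewrite -ltrD -ltr_id; apply: eq_ltr => x0.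
  rewrite /p /q -scalerDr antipode4_id addrACA subrr addr0 -mulr2n -scaler_nat.
  by rewrite scalerA mulVf // scale1r.
have lam1n0 := lam1_neq0 char0 ssH intL epsL.
move: tFE tF; rewrite lam1E tSS rp rq rF rG.
move: pq; rewrite rp rq -natrD => /(natr_inj_char0 char0) pqN -> E.
have ne : \rank (lmx p) <> \rank (lmx q).
  by move=> pq; move: lam1n0; rewrite lam1E tSS rp rq pq subrr eqxx.
set c := \rank (lmx (fun x0 => _ *: (F _ + _))) in E.
set d := \rank (lmx (fun x0 => _ *: (F _ - _))) in E.
have {}E : (\rank (lmx p) + N * d = \rank (lmx q) + N * c)%N.
  apply: (natr_inj_char0 char0); rewrite !natrD !natrM.
  apply/eqP; rewrite -subr_eq0 opprD addrACA -mulrBr -(opprB c%:R) -E mulrN.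
  by rewrite mulrA divff // mul1r subrr.
(* One of the two eigenspaces of [S^2] is zero; as [S^2] fixes [1], it is the one for -1. *)
have [] := sum_extreme_of_diff_dvd pqN E ne => /eqP; rewrite mxrank_eq0 => /eqP /lmx0_eq0 r0.
  have /eqP := r0 lp 1; rewrite /p !antipode1 -mulr2n -scaler_nat scalerA.
  by rewrite mulVf // scale1r oner_eq0.
have /eqP := r0 lq x; rewrite /q scaler_eq0 invr_eq0 (negPf n2) subr_eq0 antipode4_id.
by move/eqP.
Qed.

End Involution.

(** * The trace on V (x) H^* *)

Section TensorTrace.

Variable K : fieldType.

Lemma ltr_tensor (U V : vectType K) (f : U -> U) (g : V -> V)
    (F : tensor U V -> tensor U V) :
    linear f -> linear g -> linear F ->
    (forall u v, F (tens u v) = tens (f u) (g v)) ->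
  ltr F = ltr f * ltr g.
Proof.
move=> lf lg lF FE.
pose e := vbasis {:U}; pose e' := vbasis {:V}.
pose xi i : 'Hom(U, K^o) := linfun (coord e i : U -> K^o).
pose phi (ij : 'I_(\dim {:U}) * 'I_(\dim {:V})) (t : tensor U V) : K^o :=
  coord e' ij.2 (fun_of_lfun t (xi ij.1)).
have lphi ij : linear (phi ij).
  by move=> c s t; rewrite /phi add_lfunE scale_lfunE linearP.
rewrite (@ltr_rank1 _ _ _ phi (fun ij => tens (f e`_ij.1) (g e'`_ij.2))) //.
  rewrite /ltr mulr_suml.
  under [RHS]eq_bigr => i _ do rewrite mulr_sumr.
  rewrite pair_big; apply: eq_bigr => -[i j] _ /=.
  by rewrite /phi tensE linearZ lfunE.
move=> t; rewrite {1}(tens_decomp t) /tlift (lin_sum _ _ _ lF).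
transitivity (\sum_i \sum_j phi (i, j) t *: tens (f e`_i) (g e'`_j)); last first.
  by rewrite pair_bigA; apply: eq_bigr => -[i j] _.
apply: eq_bigr => i _; rewrite FE.
set ti := fun_of_lfun _ _.
rewrite {1}(coord_vbasisT ti) (lin_sum _ _ _ lg).
rewrite (@lin_sum _ _ _ (tens (f e`_i))); last by lin.
apply: eq_bigr => j _.
by rewrite (linZ _ _ lg) (@linZ _ _ _ (tens (f e`_i))) //; lin.
Qed.

End TensorTrace.

(** * Elements of [H (x) H^*] as endomorphisms of [H] under convolution *)

Section Evaluation.

Variables (K : fieldType) (H : hopfAlgType K).
Implicit Types (x y : tensor H (dual H)) (h : H).

(* The identification of H (x) H^* with Hom(H, H), under which the product
   becomes convolution. *)
Definition tens_ev h x : H := tlift (fun (a : H) (alpha : dual H) => deval alpha h *: a) x.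

Lemma lin_deval alpha : linear (deval alpha : H -> K^o).
Proof. exact: deval_linear. Qed.

Lemma lin_dual_deval h : linear (fun alpha : dual H => deval alpha h : K^o).
Proof. by move=> c s t; rewrite devalD devalZ. Qed.

Lemma lin_tens_evr h : linear (tens_ev h).
Proof.
apply: tlift_linear => a.
exact: (@lin_scalel _ _ _ (fun alpha : dual H => deval alpha h : K^o) a (lin_dual_deval h)).
Qed.

Lemma tens_evE h a alpha : tens_ev h (tens a alpha) = deval alpha h *: a.
Proof.
rewrite /tens_ev tlift_tens // => [alpha'|a']; first by lin.
exact: (@lin_scalel _ _ _ (fun alpha : dual H => deval alpha h : K^o) a' (lin_dual_deval h)).
Qed.

Lemma tens_evM h x y :
  tens_ev h (x * y) = \sw_(h1, h2 <- h) (tens_ev h1 x * tens_ev h2 y).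
Proof.
have sw0 : \sw_(h1, h2 <- h) (0 : H) = 0 by rewrite /sw /tlift big1.
elim/tens_ind: x => [a alpha||x x' IH IH']; last 2 first.
- rewrite mul0r (lin0 (lin_tens_evr h)) -[LHS]sw0; apply: eq_sw => h1 h2.
  by rewrite (lin0 (lin_tens_evr h1)) mul0r.
- rewrite mulrDl (linD _ _ (lin_tens_evr h)) IH IH' /sw /tlift -big_split.
  by apply: eq_bigr => i _; rewrite (linD _ _ (lin_tens_evr _)) mulrDl.
elim/tens_ind: y => [b beta||x x' IH IH']; last 2 first.
- rewrite mulr0 (lin0 (lin_tens_evr h)) -[LHS]sw0; apply: eq_sw => h1 h2.
  by rewrite (lin0 (lin_tens_evr h2)) mulr0.
- rewrite mulrDr (linD _ _ (lin_tens_evr h)) IH IH' /sw /tlift -big_split.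
  by apply: eq_bigr => i _; rewrite (linD _ _ (lin_tens_evr _)) mulrDr.
rewrite -[tens a alpha * _]/(tens_mul _ _) tens_mulE tens_evE dual_mulE.
rewrite (@linear_tlift _ _ _ _ _ _ (fun c : K^o => (c : K) *: (a * b))); last by lin.
apply: eq_sw => h1 h2; rewrite !tens_evE.
by rewrite -scalerAl -scalerAr scalerA.
Qed.

Variable tau : {lrmorphism H -> H}.

Lemma lin_iter_tau i : linear (iter i tau).
Proof. by elim: i => [|i IH] c x y //=; rewrite IH linearP. Qed.

Lemma deval_transpose i (alpha : dual H) h :
  deval (iter i (transpose tau) alpha) h = deval alpha (iter i tau h).
Proof.
elim: i h => // i IH h; rewrite [in RHS]iterSr /= -IH {1}/transpose [LHS]/deval.
have lt : linear (fun h : H => deval (iter i (transpose tau) alpha) (tau h) : K^o).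
  by move=> c x y; rewrite linearP deval_linear.
by rewrite linfunE.
Qed.

End Evaluation.

(** * Powers of [q_tau] and twisted Sweedler powers *)

Section TwistedPowers.

Variables (K : fieldType) (H : hopfAlgType K).
Variable tau : {lrmorphism H -> H}.

Lemma lin_twisted_mul i n : linear (@twisted_mul K H tau i n).
Proof.
elim: n i => [|n IH] i; first exact: lin_iter_tau.
apply: tlift_linear => a; apply: lin_mulr; exact: IH.
Qed.

Variables (n : nat) (b : n.-tuple H) (b_basis : basis_of {:H} b).

(** The factor of [q_tau] of index [i], with [i] unbounded so that a power of [q_tau] becomes one
    long product. *)
Definition can_tens i : tensor H (dual H) :=
  \sum_(j < n) tens b`_j (iter i (transpose tau) (dual_basis b j)).

Lemma tens_ev_can i h : tens_ev h (can_tens i) = iter i tau h.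
Proof.
rewrite /can_tens (lin_sum _ _ _ (lin_tens_evr h)).
rewrite [RHS](coord_basis b_basis (memvf _)); apply: eq_bigr => j _.
by rewrite tens_evE deval_transpose /deval lfunE.
Qed.

(** A product of [m.+1] factors matches [comul_iter m], which has [m.+1] legs; the free start [i]
    lets the induction peel off the first factor. *)
Lemma tens_ev_prod i m h :
  tens_ev h (\prod_(j <- iota i m.+1) can_tens j) =
  @twisted_mul K H tau i m (@comul_iter K H m h).
Proof.
elim: m i h => [|m IH] i h; first by rewrite big_seq1 tens_ev_can.
have lt := lin_iter_tau tau i; have lm := @lin_twisted_mul i.+1 m.
rewrite big_cons tens_evM /= tlift_tmap; last 2 first.
- by move=> v; apply: lin_mull.
- by move=> u; apply: lin_mulr.
by apply: eq_sw => h1 h2; rewrite tens_ev_can IH.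
Qed.

Variables (r : nat) (tau_r : iter r tau =1 id).

Lemma can_tens_period i : can_tens (r + i) = can_tens i.
Proof.
apply: eq_bigr => j _; congr (tens _ _); apply: dualP => h.
by rewrite !deval_transpose addnC iterD tau_r.
Qed.

(** As [tau^r] is the identity, the factors are periodic in their index, so successive copies of
    [q_tau] continue the same product. *)
Lemma q_tau_exp k : q_tau b tau r ^+ k = \prod_(j <- iota 0 (k * r)) can_tens j.
Proof.
elim: k => [|k IH]; first by rewrite big_nil.
rewrite exprS IH mulSn iotaD big_cat add0n /=.
have -> : iota r (k * r) = [seq (r + i)%N | i <- iota 0 (k * r)].
  by rewrite -iotaDl addn0.
rewrite big_map; congr (_ * _); last by apply: eq_bigr => i _; rewrite can_tens_period.
by rewrite -{2}[r]subn0 -/(index_iota 0 r) big_mkord.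
Qed.

Lemma twisted_power_ev k h : (0 < k * r)%N ->
  twisted_sweedler_power tau (k * r) h = tens_ev h (q_tau b tau r ^+ k).
Proof.
by move=> kr; rewrite q_tau_exp -(prednK kr) tens_ev_prod.
Qed.

End TwistedPowers.

(** * Traces on [H^*] and on [V (x) H^*] *)

Section DualTrace.

Variables (K : closedFieldType) (H : hopfAlgType K).
Hypotheses (char0 : [pchar K] =i pred0) (ssH : semisimple H).
Variable L : H.
Hypotheses (intL : integral L) (epsL : counit L = 1).
Local Notation S := (@antipode K H).
Local Notation lam := (@lam K H).
Local Notation N := (\dim {:H}).

(** Left multiplication by [phi] is the transpose of [G], so the traces agree. With [S^2 = id], the
    product [S(p) a = S(S(a) p)] contracts to the counit, leaving [lam 1 = N] times
    [phi(S L) = phi(L)]. *)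
Lemma ltr_dual_mul (phi : dual H) :
  ltr (fun beta : dual H => phi * beta) = N%:R * deval phi L.
Proof.
have SS := antipode2_id char0 ssH intL epsL.
pose f : H -> K^o := deval phi; have lf : linear f := lin_deval phi;
  have llam := @lin_lam K H.
have lS : linear S by exact: linearP.
pose G h : H := \sw_(a, b <- h) ((f a : K) *: b).
have lG : linear G by rewrite /G; lin.
have lam1 : lam 1 = N%:R.
  by rewrite -ltr_id; apply: eq_ltr => x; rewrite SS mulr1.
pose e := vbasis {:H}.
pose xi i : dual H := linfun (coord e i : H -> K^o).
have xiE i h : deval (xi i) h = coord e i h by rewrite /deval lfunE.
transitivity (ltr G).
  rewrite (@ltr_rank1 _ _ _ (fun (i : 'I_N) (beta : dual H) => deval beta e`_i : K^o)
    (fun i => phi * xi i)).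
  - apply: eq_bigr => i _; rewrite dual_mulE /G.
    have lc : linear (coord e i : H -> K^o) by exact: linearP.
    rewrite (lin_sw _ _ lc); apply: (@eq_sw _ _ K^o) => a c.
    by rewrite xiE linearZ.
  - by move=> i; exact: lin_dual_deval.
  move=> beta; rewrite (_ : \sum_i _ = phi * \sum_(i < N) deval beta e`_i *: xi i); last first.
    by rewrite mulr_sumr; apply: eq_bigr => i _; rewrite scalerAr.
  congr (_ * _); apply: dualP => h.
  rewrite {1}(coord_vbasisT h) (lin_sum _ _ _ (lin_deval beta)).
  rewrite (@lin_sum _ _ _ (fun beta => deval beta h : K^o)); last exact: lin_dual_deval.
  apply: eq_bigr => i _; rewrite devalZ xiE (linZ _ _ (lin_deval beta)).
  exact: mulrC.
rewrite (ltr_dual_bases intL epsL lG).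
transitivity (\sw_(a, t <- L) \sw_(p, q <- t)
   ((f (S q) : K) *: lam (S p * a)) : K^o).
  apply: (@eq_sw _ _ K^o) => a t; rewrite {1}/G sw_antipode; try by lin.
  rewrite (@lin_sw _ _ _ _ (fun x => lam (x * a))); last by lin.
  apply: (@eq_sw _ _ K^o) => p q.
  by rewrite (@linZ _ _ _ (fun x => lam (x * a))) //; lin.
rewrite -(@swA _ _ K^o L (fun a p q => (f (S q) : K) *: lam (S p * a))); try by lin.
transitivity (\sw_(s, q <- L) (counit s *: ((f (S q) : K) *: lam 1)) : K^o).
  apply: (@eq_sw _ _ K^o) => s q.
  have lb : linear (fun y => (f (S q) : K) *: lam (S y) : K^o) by lin.
  have := sw_antipodel s lb; rewrite antipode1 => <-.
  by apply: (@eq_sw _ _ K^o) => a p; rewrite antipodeM SS.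
rewrite (@sw_counitl _ _ K^o _ (fun q => (f (S q) : K) *: lam 1)); last by lin.
by rewrite (antipode_integral intL epsL) lam1; apply: mulrC.
Qed.

(** Both sides are linear in [x]; on a pure tensor the trace factors, and [ltr_dual_mul] evaluates
    the factor on the dual. *)
Lemma lftrace_tens_act (V : vectType K) (rho : hmodule H V) (x : tensor H (dual H)) :
  lftrace (tens_act rho x) = N%:R * hchar rho (tens_ev L x).
Proof.
have lE c gamma t : linfun (tmap (rho c) (fun beta : dual H => gamma * beta)) t =
    tmap (rho c) (fun beta : dual H => gamma * beta) t.
  by apply: linfunE; apply: tlift_linear => v; apply: lin_tensr; exact: lin_mulr.
have lact : linear (tens_act rho).
  suff l2 (a : H) : linear (fun alpha : dual H =>
      linfun (tmap (rho a) (fun beta : dual H => alpha * beta))).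
    move=> c x' y'; rewrite /tens_act /tlift scaler_sumr -big_split.
    by apply: eq_bigr => i _; rewrite add_lfunE scale_lfunE l2.
  move=> c alpha beta.
  apply/lfunP => t.
  rewrite add_lfunE scale_lfunE !lE /tmap /tlift scaler_sumr -big_split.
  apply: eq_bigr => i _ /=.
  by rewrite mulrDl -scalerAl tens_linearr.
have ltrace : linear (fun f : 'End(tensor V (dual H)) => lftrace f : K^o).
  move=> c f g; rewrite !lftraceE /ltr scaler_sumr -big_split.
  by apply: eq_bigr => i _; rewrite add_lfunE scale_lfunE linearP.
have lchar : linear (hchar rho : H -> K^o).
  move=> c a h; rewrite /hchar linearP !lftraceE /ltr scaler_sumr -big_split.
  by apply: eq_bigr => i _; rewrite add_lfunE scale_lfunE linearP.
have lev := lin_tens_evr L.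
elim/tens_ind: x => [a alpha||x y IH IH'].
- rewrite lftraceE (@ltr_tensor _ _ _ (rho a) (fun beta => alpha * beta)).
  + rewrite ltr_dual_mul tens_evE (linZ _ _ lchar) /hchar lftraceE.
    by rewrite mulrC -mulrA.
  + exact: lin_hom.
  + exact: lin_mulr.
  + exact: lin_hom.
  + by move=> v beta; rewrite tens_actE.
- by rewrite (lin0 lact) (lin0 ltrace) (lin0 lev) (lin0 lchar) mulr0.
rewrite (linD _ _ lact) (linD _ _ ltrace) IH IH' (linD _ _ lev) (linD _ _ lchar).
by rewrite mulrDr.
Qed.

End DualTrace.

Theorem theorem4p1 (K : closedFieldType) (char0 : [pchar K] =i pred0)
    (H : hopfAlgType K) (ssH : semisimple H)
    (Lambda : H) (intL : integral Lambda) (epsL : counit Lambda = 1)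
    (tau : {lrmorphism H -> H}) (tau_aut : hopf_automorphism tau)
    (r : nat) (tau_ord : has_order tau r)
    (V : vectType K) (rho : hmodule H V)
    (n : nat) (b : n.-tuple H) (b_basis : basis_of {:H} b)
    (k : nat) (k_gt0 : (0 < k)%N) :
  twisted_indicator Lambda tau rho (k * r) =
    (\dim {:H})%:R^-1 * lftrace (tens_act rho (q_tau b tau r ^+ k)).
Proof.
have r0 : (0 < r)%N by case: tau_ord.
have tau_r : iter r tau =1 id by case: tau_ord.
have n0 : (\dim {:H})%:R != 0 :> K.
  rewrite (natr_eq0_char0 char0) -lt0n lt0n dimv_eq0.
  by apply: contraTneq (memvf (1 : H)) => ->; rewrite memv0 oner_eq0.
(* The factor [N] cancels, and the value of [q_tau ^+ k] at the integral is the twisted Sweedler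
   power. *)
rewrite (lftrace_tens_act char0 ssH intL epsL) mulKf // /twisted_indicator.
by rewrite (twisted_power_ev b_basis tau_r) // muln_gt0 k_gt0.
Qed.
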